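(* Let $k$ be a fixed positive integer (not depending on $n$). For the binomial random intersection graph $G_b(n,P_n,p_n)$, define the sequence $\alpha_n$ by $$p_n^2P_n=\frac{\ln n+(k-1)\ln\ln n+\alpha_n}{n}.$$ If $P_n=\omega\big(n(\ln n)^5\big)$ and $|\alpha_n|=o(\ln n)$, then $$\lim_{n\to\infty}\mathbb{P}[G_b(n,P_n,p_n)\text{ is }k\text{-connected}]=\begin{cases}0,&\text{if }\lim_{n\to\infty}\alpha_n=-\infty,\\ 1,&\text{if }\lim_{n\to\infty}\alpha_n=\infty,\\ e^{-\frac{e^{-\alpha^*}}{(k-1)!}},&\text{if }\lim_{n\to\infty}\alpha_n=\alpha^*\in(-\infty,\infty).\end{cases}$$
   Context: Binomial random intersection graph $G_b(n,P_n,p_n)$: there are $n$ nodes $v_1,\ldots,v_n$ and a pool of $P_n$ distinct objects ($P_n$ a positive integer, $p_n\in[0,1]$); each node $v_i$ gets an object set $S_i$ obtained by including each object of the pool independently with probability $p_n$, independently over nodes. Distinct nodes $v_i,v_j$ are adjacent iff $S_i\cap S_j\neq\emptyset$. A graph is $k$-connected if every pair of nodes is joined by at least $k$ internally node-disjoint paths. All limits and asymptotic notation are as $n\to\infty$. *)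

(* Defs.v *)
From mathcomp Require Import all_boot all_order all_algebra.
From mathcomp Require Import all_classical all_reals all_analysis.

Set Implicit Arguments.
Unset Strict Implicit.
Unset Printing Implicit Defensive.

Import Order.TTheory GRing.Theory Num.Theory.
Import numFieldNormedType.Exports.

Local Open Scope classical_set_scope.
Local Open Scope ring_scope.

Section Connectivity.
Variables (T : finType) (e : rel T).

(* The sequence s lists the vertices of the path without its origin u. *)
Definition simple_path (u v : T) (s : seq T) : Prop :=
  [/\ path e u s, last u s = v & uniq (u :: s)].

Definition interior (u : T) (s : seq T) : seq T := behead (belast u s).

(* Distinctness is required separately: a single edge has empty interior, so
   without it an edge could be counted arbitrarily often. *)
Definition internally_disjoint_paths (k : nat) (u v : T)
    (s : 'I_k -> seq T) : Prop :=
  (forall i, simple_path u v (s i)) /\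
  (forall i j, i != j ->
     s i != s j /\ ~~ has (mem (interior u (s i))) (interior u (s j))).

Definition k_connected (k : nat) : Prop :=
  forall u v : T, u != v ->
    exists s : 'I_k -> seq T, internally_disjoint_paths u v s.

End Connectivity.

Definition object_assignment (n m : nat) := {ffun 'I_n -> {set 'I_m}}.

Definition intersection_graph (n m : nat) (S : object_assignment n m) :
    rel 'I_n :=
  fun i j => (i != j) && (S i :&: S j != finset.set0)%SET.

Section BinomialRandomIntersectionGraph.
Variable R : realType.

Definition assignment_weight (n m : nat) (p : R)
    (S : object_assignment n m) : R :=
  \prod_(i < n) \prod_(o < m) (if o \in S i then p else 1 - p).

Definition binomial_rig_prob (n m : nat) (p : R)
    (Q : rel 'I_n -> Prop) : R :=
  \sum_(S : object_assignment n m | `[< Q (intersection_graph S) >])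
    assignment_weight p S.

Definition little_omega (f g : nat -> R) : Prop := g =o_\oo f.

End BinomialRandomIntersectionGraph.

(* Main.v *)
(** Write lam = n p^2 P and eps = n p; the assumption on P gives lam eps -> 0.

    The connection probability is monotone in p (thin the random bits), so the two zero-one laws
    follow from the critical case alpha -> alpha*, applied to constant sequences alpha.

    In the critical case let U be the set of objects owned by a node set A.  U is a Bernoulli
    random set, and given U the nodes outside A are adjacent to A independently, each with
    probability 1 - (1 - p)^#|U|.  Binomial moment bounds for #|U| then estimate the probability
    that A has few outside neighbours.  An edge inside A costs a further factor at most
    #|A|^2 lam / n, because having few outside neighbours is a decreasing event.  When there is no
    such edge the object sets of the nodes of A are disjoint and the outside degrees are
    conditionally independent.  Hence the factorial moments of the number of nodes of degree less
    than k converge to those of a Poisson variable of mean exp(-alpha* ) / (k-1)!, and the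
    Bonferroni inequalities give the limit of the probability that the minimum degree is at
    least k.

    By Menger's theorem, a graph of minimum degree at least k that is not k-connected has a set A
    with 2 <= #|A| <= n / 2, fewer than k outside neighbours and an inner edge.  A union bound
    over A shows that this has vanishing probability; the inner edge is only needed when
    #|A|^2 <= n. *)

Require Import Defs.
From mathcomp Require Import all_boot all_order all_algebra.
From mathcomp Require Import ring lra zify boolp.

Set Implicit Arguments.
Unset Strict Implicit.
Unset Printing Implicit Defensive.

Import Order.TTheory GRing.Theory Num.Theory.

(** * Menger's theorem *)

Section Menger.
Variable T : finType.
Implicit Types (e : rel T) (X Y S Z : {set T}) (w : T * seq T).

(** The limit depends on the exponent [lam] up to o(1), whereas linearising a hit probability
    [1 - (1 - p) ^+ a] to [a * p] costs a relative error of order [eps]; hence the need for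
    [lam * eps] to vanish, and not merely [eps]. Outside neighbours of a set are independent only
    given its objects, so their number follows a mixed binomial law. Upper bounds use weighted
    moments of [#|U|]. Lower bounds replace a power by its tangent at the typical value [lam / n],
    which leaves exact void probabilities and avoids any concentration estimate. The inner edge is
    indispensable in the union bound over small sets: for connectedness, the expected number of
    pairs without outside neighbours tends to a positive constant, and only the factor [lam / n] of
    the edge removes it. Once [#|A| ^ 2 > n] that factor gains nothing, but then the binomial
    coefficient is at most [(e n / a) ^ a], and its [a ^ a] in the denominator is large enough. *)

Definition verts w := w.1 :: w.2.

(** A walk is its origin with the list of its further vertices. The list may be empty, so a vertex
    common to [X] and [Y] joins them by itself. *)
Definition joins e X Y w := [/\ w.1 \in X, path e w.1 w.2 & last w.1 w.2 \in Y].

Definition separates e X Y S := forall w, joins e X Y w -> has (mem S) (verts w).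

Definition linked e X Y k := exists F : 'I_k -> T * seq T,
  (forall i, joins e X Y (F i)) /\
  (forall i j, i != j -> ~~ has (mem (verts (F i))) (verts (F j))).

Definition del_edge e (x0 y0 : T) : rel T := [rel x y | e x y && ((x, y) != (x0, y0))].

Lemma path_del_source e x0 y0 x s :
  path e x s -> x0 \notin belast x s -> path (del_edge e x0 y0) x s.
Proof.
elim: s x => //= y s IH x /andP[exy es]; rewrite inE negb_or => /andP[xx0 x0s].
by rewrite /del_edge /= exy IH // xpair_eqE negb_and eq_sym xx0.
Qed.

Lemma path_del_target e x0 y0 x s :
  path e x s -> y0 \notin s -> path (del_edge e x0 y0) x s.
Proof.
elim: s x => //= y s IH x /andP[exy es]; rewrite inE negb_or => /andP[yy0 y0s].
by rewrite /del_edge /= exy IH // xpair_eqE negb_and [y == _]eq_sym yy0 orbT.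
Qed.

Lemma split_first_hit Z x s : has (mem Z) (x :: s) ->
  exists s1 s2, [/\ s = s1 ++ s2, last x s1 \in Z & ~~ has (mem Z) (belast x s1)].
Proof.
elim: s x => [|y s IH] x; first by rewrite has_seq1 => xZ; exists [::], [::].
rewrite [has _ _]/=; case xZ: (x \in Z) => /=; first by exists [::], (y :: s).
case/IH=> s1 [s2 [-> l h]]; exists (y :: s1), s2; split=> //=.
by rewrite negb_or xZ.
Qed.

Lemma split_last_hit Z x s : has (mem Z) (x :: s) ->
  exists y s1 s2, [/\ x :: s = s1 ++ y :: s2, y \in Z & ~~ has (mem Z) s2].
Proof.
elim: s x => [|y s IH] x; first by rewrite has_seq1 => xZ; exists x, [::], [::].
case ys: (has (mem Z) (y :: s)).
  move=> _; have [z [s1 [s2 [E zZ h]]]] := IH _ ys.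
  by exists z, (x :: s1), s2; rewrite E.
rewrite [has _ _]/= -[(y \in Z) || _]/(has (mem Z) (y :: s)) ys orbF => xZ.
by exists x, [::], (y :: s); rewrite ys.
Qed.

Lemma linked_uniq e X Y k : linked e X Y k -> exists F : 'I_k -> T * seq T,
  [/\ forall i, joins e X Y (F i),
      forall i j, i != j -> ~~ has (mem (verts (F i))) (verts (F j)) &
      forall i, uniq (verts (F i))].
Proof.
case=> F [FP Fd].
have /fin_all_exists[G GP] i : exists w, [/\ joins e X Y w, uniq (verts w) &
    {subset verts w <= verts (F i)}].
  case: (F i) (FP i) => x s [/= xX ps lY].
  case/shortenP: ps lY => s' ps' us' ss' lY; exists (x, s'); split => //.
  by move=> y; rewrite !inE => /orP[->//|/ss' ->]; rewrite orbT.
exists G; split=> [i|i j ij|i]; try by case: (GP i).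
apply/hasPn => y yj; have [_ _ sj] := GP j; have [_ _ si] := GP i.
apply/negP => /= yi; have /hasPn/(_ _ (sj _ yj))/negP := Fd i j ij; apply.
exact: si.
Qed.

Lemma inj_ord_onto k (f : 'I_k -> T) Z : injective f -> (forall i, f i \in Z) ->
  #|Z| = k -> forall z, z \in Z -> exists i, f i = z.
Proof.
move=> fi fZ Zk z zZ.
have E : f @: [set: 'I_k] = Z.
  apply/eqP; rewrite eqEcard card_imset // cardsT card_ord Zk leqnn andbT.
  by apply/subsetP => y /imsetP[i _ ->].
by move: zZ; rewrite -E => /imsetP[i _ ->]; exists i.
Qed.

Lemma edge_on_path e x0 y0 x s : path e x s -> ~~ path (del_edge e x0 y0) x s ->
  x0 \in x :: s /\ y0 \in s.
Proof.
move=> ps nps; split; apply: contraNT nps => h.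
  apply: path_del_source => //; apply: contra h => /mem_belast; exact.
exact: path_del_target.
Qed.

(* Induction on the edges: if deleting the edge (x0, y0) creates a small separator S, link X to
   x0 |: S and y0 |: S to Y in the smaller graph and glue the two systems along S and (x0, y0). *)
Theorem menger e X Y k :
  (forall S, separates e X Y S -> k <= #|S|) -> linked e X Y k.
Proof.
have [m] := ubnP #|[set z : T * T | e z.1 z.2]|.
elim: m e X Y => // m IH e X Y me sepk.
case: (pickP [pred z : T * T | e z.1 z.2]) => [[x0 y0] /= e0|noe]; last first.
  (* Without edges only one-vertex paths exist, so [X :&: Y] is itself a separator. *)
  have XY : k <= #|X :&: Y|.
    apply: sepk => -[x [|y s]] [/= xX ps lY]; first by rewrite inE xX lY.
    by case/andP: ps => exy _; have := noe (x, y); rewrite /= exy.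
  exists (fun i => (enum_val (widen_ord XY i), [::])); split=> [i|i j ij] /=.
    by have := enum_valP (widen_ord XY i); rewrite inE => /andP[].
  rewrite !inE orbF; apply: contra ij => /eqP /enum_val_inj /(congr1 val) /= ji.
  by apply/eqP/val_inj.
set e' := del_edge e x0 y0.
have sube : subrel e' e by move=> x y /andP[].
have m' : #|[set z : T * T | e' z.1 z.2]| < m.
  apply: leq_trans (_ : #|[set z : T * T | e z.1 z.2]| <= m) => //.
  apply: proper_card; apply/properP; split.
    by apply/subsetP => z; rewrite !inE => /sube.
  by exists (x0, y0); rewrite inE // /e' /del_edge /= eqxx andbF.
have [all|nall] := pselect (forall S, separates e' X Y S -> k <= #|S|).
  have [F [FP Fd]] := IH e' X Y m' all; exists F; split=> // i.
  by have [? pF ?] := FP i; split=> //; apply: sub_path pF.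
have {nall}[S [sepS Sk]] : exists S, separates e' X Y S /\ #|S| < k.
  have /existsNP[S /not_implyP[sS Sk]] := nall.
  by exists S; split=> //; rewrite ltnNge; apply/negP.
have used w : joins e X Y w -> ~~ has (mem S) (verts w) ->
    (x0 \in verts w) /\ (y0 \in w.2).
  case=> wX pw wY nS; apply: edge_on_path (pw) _; apply: contra nS => pw'.
  by apply: sepS.
have sepx : separates e X Y (x0 |: S).
  move=> w jw; case hS: (has (mem S) (verts w)).
    by case/hasP: hS => y yw yS; apply/hasP; exists y; rewrite //= inE (yS : y \in S) orbT.
  have [x0w _] := used w jw (negbT hS).
  by apply/hasP; exists x0 => //=; rewrite setU11.
have sepy : separates e X Y (y0 |: S).
  move=> w jw; case hS: (has (mem S) (verts w)).
    by case/hasP: hS => y yw yS; apply/hasP; exists y; rewrite //= inE (yS : y \in S) orbT.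
  have [_ y0w] := used w jw (negbT hS).
  by apply/hasP; exists y0; rewrite /= ?setU11 // inE y0w orbT.
have cx : (#|x0 |: S| = k) /\ (x0 \notin S).
  by have := sepk _ sepx; rewrite cardsU1; case: (x0 \in S) => /=; lia.
have cy : (#|y0 |: S| = k) /\ (y0 \notin S).
  by have := sepk _ sepy; rewrite cardsU1; case: (y0 \in S) => /=; lia.
have {cx}[cx x0S] := cx; have {cy}[cy y0S] := cy.
(* Cut an [X]-[Y] path at its first visit to [x0 |: S]: the initial segment never leaves [x0], so it
   survives the deletion of the edge. Hence a separator of [X] from [x0 |: S] in [e'] separates [X]
   from [Y] in [e]. For [linky] the cut is at the last visit to [y0 |: S]. *)
have linkx : linked e' X (x0 |: S) k.
  apply: IH => // S' sS'; apply: sepk => -[x s] jw; have hZ := sepx _ jw.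
  have {hZ}[s1 [s2 [E lZ nb]]] := @split_first_hit (x0 |: S) x s hZ.
  have [xX ps _] := jw; rewrite /= in xX ps.
  have p1 : path e x s1 by move: ps; rewrite E cat_path => /andP[].
  have : joins e' X (x0 |: S) (x, s1).
    split=> //=; apply: path_del_source => //; apply: contra nb => x0b.
    by apply/hasP; exists x0 => //=; rewrite setU11.
  move=> /sS' /hasP[y y1 yS']; apply/hasP; exists y => //.
  by rewrite /verts /= E -cat_cons mem_cat (y1 : y \in x :: s1).
have linky : linked e' (y0 |: S) Y k.
  apply: IH => // S' sS'; apply: sepk => -[x s] jw; have hZ := sepy _ jw.
  have {hZ}[y [s1 [s2 [E yZ nb]]]] := @split_last_hit (y0 |: S) x s hZ.
  have [xX ps lY] := jw; rewrite /= in xX ps lY.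
  have [py ly] : path e y s2 /\ last x s = last y s2.
    case: s1 E => [[<- <-]//|z s1 [xz E']].
    by move: ps; rewrite E' cat_path /= last_cat /= => /and3P[].
  have : joins e' (y0 |: S) Y (y, s2).
    split=> //=; last by rewrite -ly.
    apply: path_del_target => //; apply: contra nb => y0b.
    by apply/hasP; exists y0 => //=; rewrite setU11.
  move=> /sS' /hasP[z z1 zS']; apply/hasP; exists z => //.
  by rewrite /verts /= E mem_cat (z1 : z \in y :: s2) orbT.
have [P [PJ Pd Pu]] := linked_uniq linkx.
have [Q [QJ Qd Qu]] := linked_uniq linky.
pose pe i := last (P i).1 (P i).2; pose qs i := (Q i).1.
have peV i : pe i \in verts (P i) by rewrite mem_last.
have qsV i : qs i \in verts (Q i) by rewrite inE eqxx.
have Pdj i j z : z \in verts (P i) -> z \in verts (P j) -> i = j.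
  move=> zi zj; apply/eqP; apply: contraTT (zj) => /Pd /hasPn h.
  by apply/negP => /h /=; rewrite zi.
have Qdj i j z : z \in verts (Q i) -> z \in verts (Q j) -> i = j.
  move=> zi zj; apply/eqP; apply: contraTT (zj) => /Qd /hasPn h.
  by apply/negP => /h /=; rewrite zi.
have peZ i : pe i \in x0 |: S by case: (PJ i).
have qsZ i : qs i \in y0 |: S by case: (QJ i).
have pei : injective pe by move=> i j E; apply: (Pdj _ _ (pe i)); rewrite ?peV // E peV.
have qsi : injective qs by move=> i j E; apply: (Qdj _ _ (qs i)); rewrite ?qsV // E qsV.
have Pend i z : z \in verts (P i) -> z \in S -> z = pe i.
  move=> zi zS; have [j E] : exists j, pe j = z.
    by apply: inj_ord_onto pei peZ cx _ _; rewrite inE zS orbT.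
  by rewrite -E; congr pe; apply: (Pdj _ _ z); rewrite -?E // E.
have Qstart i z : z \in verts (Q i) -> z \in S -> z = qs i.
  move=> zi zS; have [j E] : exists j, qs j = z.
    by apply: inj_ord_onto qsi qsZ cy _ _; rewrite inE zS orbT.
  by rewrite -E; congr qs; apply: (Qdj _ _ z); rewrite -?E // E.
(* Following [P i] up to [v] and then [Q j] gives an [X]-[Y] path in [e'], which meets [S]. A [P]
   path meets [S] only at its end and a [Q] path only at its start, so [v] is that point. *)
have meet i j v : v \in verts (P i) -> v \in verts (Q j) -> v \in S /\ (pe i = v /\ qs j = v).
  move=> vi vj; suff vS : v \in S by split; [|split; rewrite -?(Pend i v) -?(Qstart j v)].
  have := PJ i; have := QJ j; have := Pu i; have := Qu j.
  move: vi vj (Pend i) (Qstart j); rewrite /pe /qs /verts.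
  case: (P i) (Q j) => [x s] [y t] /= vi vj Pe Qs ut us [yZ pt lt] [xX ps ls].
  case/splitPl: vi ps us Pe ls => s1 s2 ls1; rewrite cat_path => /andP[ps1 ps2] us Pe ls.
  have [t1 [t2 [E1 pt2 lt2]]] : exists t1 t2, [/\ y :: t = t1 ++ v :: t2, path e' v t2 &
      last v t2 = last y t].
    case/splitPl: vj pt {ut Qs lt} => t1 t2 lt1; rewrite cat_path lt1 => /andP[_ pt2].
    exists (belast y t1), t2; split=> //; last by rewrite last_cat lt1.
    by rewrite -cat_cons lastI lt1 cat_rcons.
  have /hasP[z /= zin zS] : has (mem S) (verts (x, s1 ++ t2)).
    apply: sepS; split=> //=; first by rewrite cat_path ps1 ls1.
    by rewrite last_cat ls1 lt2.
  move: zin; rewrite /verts /= -cat_cons mem_cat => /orP[z1|z2].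
    have zl : z = last x (s1 ++ s2) by apply: Pe => //; rewrite -cat_cons mem_cat z1.
    suff -> : v = z by [].
    rewrite zl last_cat ls1.
    have : uniq ((x :: s1) ++ s2) := us; rewrite cat_uniq => /and3P[_ h _].
    case: (s2) h zl => [//|a s3] h zl; case/negP: h; apply/hasP; exists z => //.
    by rewrite zl last_cat /= mem_last.
  have zy : z = y by apply: Qs => //; rewrite E1 mem_cat inE z2 !orbT.
  case: t1 E1 => [[<-] _|b t1 [yb E1]]; first by rewrite -zy.
  by move: ut; rewrite E1 mem_cat inE -zy z2 !orbT.
(* [P i] continues with the [Q] path that starts where it ends; the one ending at [x0] takes the
   deleted edge to [y0]. *)
have /fin_all_exists[tau tauP] i : exists j, qs j = if pe i \in S then pe i else y0.
  apply: inj_ord_onto qsi qsZ cy _ _; case: ifP => peS; rewrite ?setU11 //.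
  by rewrite inE peS orbT.
exists (fun i => ((P i).1, (P i).2 ++ (if pe i \in S then (Q (tau i)).2 else verts (Q (tau i))))).
have Vs i z : z \in verts ((P i).1, (P i).2 ++ (if pe i \in S then (Q (tau i)).2
    else verts (Q (tau i)))) -> z \in verts (P i) \/ z \in verts (Q (tau i)).
  rewrite /verts /= -cat_cons mem_cat => /orP[->|H]; first by left.
  by right; move: H; case: ifP => // _ zq; rewrite inE zq orbT.
split=> [i|i j ij].
  have [PX Pp _] := PJ i; have [_ Qp Ql] := QJ (tau i); have H := tauP i.
  rewrite /qs in H; split=> //=; last first.
    rewrite last_cat -/(pe i); move: H; case: ifP => _ E; last by [].
    by rewrite -E.
  rewrite cat_path (sub_path sube Pp) -/(pe i) /=; have Qp' := sub_path sube Qp.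
  move: (peZ i) H; case: ifP => peS; first by move=> _ <-.
  rewrite !inE peS orbF => /eqP-> Ey; rewrite /verts /= Qp' andbT.
  by rewrite Ey.
apply/hasPn => z zj; apply/negP => /= zi.
case/Vs: zi => zi; case/Vs: zj => zj.
- by move/eqP: ij; apply; apply: (Pdj _ _ z).
- have [zS [pi qj]] := meet _ _ _ zi zj; move: (tauP j); rewrite qj.
  case: ifP => [_ E|_ E]; last by move: y0S; rewrite -E zS.
  by move/eqP: ij; apply; apply: pei; rewrite pi.
- have [zS [pj qi]] := meet _ _ _ zj zi; move: (tauP i); rewrite qi.
  case: ifP => [_ E|_ E]; last by move: y0S; rewrite -E zS.
  by move/eqP: ij; apply; apply: pei; rewrite pj.
- have tij : tau i = tau j by apply: (Qdj _ _ z).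
  move: (tauP i) (tauP j); rewrite tij => ->.
  case: ifP => iS; case: ifP => jS E.
  + by move/eqP: ij; apply; apply: pei.
  + by move: y0S; rewrite -E iS.
  + by move: y0S; rewrite E jS.
  + move/eqP: ij; apply; apply: pei; move: (peZ i) (peZ j).
    by rewrite !inE iS jS !orbF => /eqP-> /eqP->.
Qed.


(** * From vertex expansion to k-connectivity *)

Definition nbrs e (A : {set T}) : {set T} :=
  [set w | (w \notin A) && [exists i in A, e i w]].

(** The first steps of the [k] paths are distinct neighbours of [u]: a shared first vertex lies in
    both interiors, unless one path is the single edge to [v], and then simplicity makes the other
    the same edge. *)
Lemma connected_min_degree e k u v : u != v -> k_connected e k -> k <= #|[set w | e u w]|.
Proof.
move=> uv /(_ u v uv)[s [sp sd]].
pose h i := head u (s i).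
have hd i : s i = h i :: behead (s i) /\ e u (h i).
  rewrite /h; have [ps ls _] := sp i; case: (s i) ps ls => [|y t] /=.
    by move=> _ /eqP; rewrite (negPf uv).
  by case/andP.
have hi : injective h.
  move=> i j hij; apply/eqP/negPn/negP => ij; have [] := sd i j ij.
  have [Ei _] := hd i; have [Ej _] := hd j; have [_ li ui] := sp i; have [_ lj uj] := sp j.
  move: li ui lj uj; rewrite Ei Ej -hij; move: (h i) => y.
  case: (behead (s i)) => [|a t]; case: (behead (s j)) => [|b t'] //=; rewrite ?eqxx //.
  - by move=> -> _ lb /and3P[_ yb _]; move: yb; rewrite -lb mem_last.
  - by move=> la /and3P[_ ya _] lb; move: ya; rewrite lb -la mem_last.
  - by rewrite /interior /= !inE eqxx.
rewrite -{1}(card_ord k) -(card_imset _ hi); apply: subset_leq_card.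
by apply/subsetP => y /imsetP[i _ ->]; rewrite inE; case: (hd i).
Qed.

(** Menger's theorem is applied to the neighbourhoods of [u] and [v] with both nodes removed, so
    that each path found becomes the interior of a path from [u] to [v]. An edge between [u] and [v]
    is one path already, so [k - e u v] others are sought. *)
Lemma expansion_k_connected e k : symmetric e ->
  (forall A : {set T}, 0 < #|A| -> 2 * #|A| <= #|T| -> k <= #|nbrs e A|) ->
  k_connected e k.
Proof.
move=> sym expand u v uv.
pose off x := (x != u) && (x != v).
pose e0 : rel T := [rel x y | [&& e x y, off x & off y]].
pose X := [set x | e u x & off x]; pose Y := [set y | e v y & off y].
have offp x s : off x -> path e0 x s -> all off (x :: s).
  elim: s x => [|y s IH] x ox /=; first by rewrite ox.
  by case/andP=> /and3P[_ _ oy] /(IH _ oy) /= ->; rewrite ox.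
have sube0 : subrel e0 e by move=> x y /and3P[].
have sep S : separates e0 X Y S -> k <= #|S| + e u v.
  move=> sepS; rewrite leqNgt; apply/negP => Sk.
  pose ok x := off x && (x \notin S).
  pose g : rel T := [rel x y | [&& e x y, ok x & ok y]].
  have okp x s : ok x -> path g x s -> all ok (x :: s) /\ path e0 x s.
    elim: s x => [|y s IH] x ox /=; first by rewrite ox.
    case/andP=> /and3P[exy _ oy] /(IH _ oy) /= [-> ->]; rewrite ox /e0 /= exy.
    by case/andP: ox => ->; case/andP: oy => ->.
  (* [A] is [u] with all that it reaches while avoiding [S] and [v]; [B] is the rest apart from
     [S']. The only possible edge between them joins [u] to [v], so the smaller of the two has too
     few neighbours. *)
  pose A := u |: [set x | [exists x1 in [set z in X | ok z], connect g x1 x]].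
  pose S' := [set z in S | off z]; pose B := ~: (A :|: S').
  have S'S : #|S'| <= #|S|.
    by apply: subset_leq_card; apply/subsetP => z; rewrite inE => /andP[].
  have uA : u \in A by rewrite setU11.
  have Aok x : x \in A -> x != u -> ok x && (x \notin Y).
    rewrite !inE => /orP[->//|/existsP[x1 /andP[]]]; rewrite !inE.
    case/andP=> /andP[eux ofx] okx /connectP[s ps ->] _.
    have [als p0] := okp _ _ okx ps.
    rewrite (allP als) ?mem_last //=; apply/negP => lY.
    have : joins e0 X Y (x1, s) by split=> //=; rewrite inE ?eux ?ofx // -in_set.
    by move=> /sepS /hasP[z zs zS]; have /andP[_] := allP als z zs; rewrite (zS : z \in S).
  have vA : v \notin A.
    by apply/negP => vA; move: (Aok v vA); rewrite eq_sym uv /ok /off eqxx andbF => /(_ isT).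
  have vB : v \in B by rewrite in_setC in_setU negb_or vA inE /off eqxx !andbF.
  have AB a b : a \in A -> b \in B -> e a b -> (a == u) && (b == v).
    move=> aA; rewrite in_setC in_setU negb_or => /andP[bA bS'] eab.
    have bu : b != u by apply: contraNneq bA => ->.
    have [au|au] := eqVneq a u.
      subst a; rewrite /=; apply: contraNT bA => bv.
      have okb : ok b by move: bS'; rewrite /ok /off !inE /off bu bv /= andbT.
      apply/setU1P; right; rewrite inE; apply/existsP; exists b; rewrite connect0 andbT.
      by rewrite !inE eab okb; case/andP: okb => ->.
    have /andP[oka aY] := Aok a aA au.
    have bv : b != v.
      apply: contraNneq aY => bv; rewrite inE sym -bv eab.
      by case/andP: oka.
    have okb : ok b by move: bS'; rewrite /ok /off !inE /off bu bv /= andbT.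
    case/negP: bA; move: aA; rewrite !in_setU1 (negPf au) /= !inE => /existsP[x1 /andP[hx1 ca]].
    apply/orP; right; apply/existsP; exists x1; rewrite hx1 /=; apply: connect_trans ca _.
    by apply: connect1; rewrite /g /= eab oka okb.
  have cardAB : #|A| + #|B| <= #|T|.
    rewrite -(cardsC A) leq_add2l; apply: subset_leq_card.
    by apply/subsetP => z; rewrite !in_setC in_setU negb_or => /andP[].
  have [hA|hB] : 2 * #|A| <= #|T| \/ 2 * #|B| <= #|T| by lia.
    have := expand A; rewrite hA card_gt0; have -> : A != set0 by apply/set0Pn; exists u.
    move=> /(_ isT isT); apply/negP; rewrite -ltnNge; apply: leq_ltn_trans Sk.
    have : #|nbrs e A| <= #|S' :|: (if e u v then [set v] else set0)|.
      apply: subset_leq_card; apply/subsetP => b; rewrite inE.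
      case/andP=> bA /existsP[a /andP[aA eab]].
      rewrite inE; have [//|bS' /=] := boolP (b \in S').
      have bB : b \in B by rewrite in_setC in_setU negb_or bA.
      by have /andP[/eqP au /eqP bv] := AB a b aA bB eab; rewrite -au -bv eab inE.
    move/leq_trans; apply; apply: (leq_trans (leq_card_setU _ _)); apply: leq_add => //.
    by case: (e u v); rewrite ?cards1 ?cards0.
  have := expand B; rewrite hB card_gt0; have -> : B != set0 by apply/set0Pn; exists v.
  move=> /(_ isT isT); apply/negP; rewrite -ltnNge; apply: leq_ltn_trans Sk.
  have : #|nbrs e B| <= #|S' :|: (if e u v then [set u] else set0)|.
    apply: subset_leq_card; apply/subsetP => a; rewrite inE => /andP[aB /existsP[b /andP[bB eba]]].
    rewrite inE; have [//|aS' /=] := boolP (a \in S').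
    have aA : a \in A by move: aB; rewrite in_setC in_setU (negPf aS') orbF negbK.
    rewrite sym in eba.
    by have /andP[/eqP au /eqP bv] := AB a b aA bB eba; rewrite -au -bv eba inE.
  move/leq_trans; apply; apply: (leq_trans (leq_card_setU _ _)); apply: leq_add => //.
  by case: (e u v); rewrite ?cards1 ?cards0.
have [F [FJ Fd Fu]] : exists F : 'I_(k - e u v) -> T * seq T,
  [/\ forall i, joins e0 X Y (F i),
      forall i j, i != j -> ~~ has (mem (verts (F i))) (verts (F j)) &
      forall i, uniq (verts (F i))].
  by apply/linked_uniq/menger => S /sep; rewrite leq_subLR addnC.
pose G i := rcons (verts (F i)) v.
have Gs i : simple_path e u v (G i).
  have := FJ i; have := Fu i; rewrite /G; case: (F i) => x s uxs [/= xX ps lY].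
  have /andP[eux ox] : e u x && off x by rewrite inE in xX.
  have /andP[evl ol] : e v (last x s) && off (last x s) by rewrite inE in lY.
  have al := offp _ _ ox ps.
  split.
  - by rewrite /= eux rcons_path (sub_path sube0 ps) sym.
  - by rewrite /= last_rcons.
  - rewrite -rcons_cons cons_uniq mem_rcons inE negb_or uv rcons_uniq uxs andbT /=.
    by apply/andP; split; apply/negP => h; have /andP[] := allP al _ h; rewrite eqxx.
have Gint i : interior u (G i) = verts (F i).
  by rewrite /interior /G belast_rcons.
have Gd i j : i != j -> G i != G j /\ ~~ has (mem (interior u (G i))) (interior u (G j)).
  move=> ij; rewrite !Gint; split; last exact: Fd.
  apply: contra (Fd i j ij) => /eqP GE; apply/hasP; exists (F j).1; rewrite ?mem_head //=.
  by rewrite -Gint GE Gint mem_head.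
have : exists G : 'I_(k - e u v) -> seq T, [/\ forall i, simple_path e u v (G i),
    forall i, interior u (G i) != [::] &
    forall i j, i != j -> G i != G j /\ ~~ has (mem (interior u (G i))) (interior u (G j))].
  by exists G; split=> // i; rewrite Gint.
case euv: (e u v); last by rewrite subn0 => -[H [Hs _ Hd]]; exists H.
case: k {expand sep F FJ Fd Fu G Gs Gint Gd} => [_|k].
  by exists (fun=> [::]); split=> [[]//|[]].
rewrite subSS subn0 => -[G [Gs Gint Gd]].
exists (fun i => if unlift ord0 i is Some j then G j else [:: v]); split=> [i|i j].
  case: (unliftP ord0 i) => [j _|_]; first exact: Gs.
  by split=> //=; rewrite ?euv // inE uv.
case: (unliftP ord0 i) => [i' ->|->]; case: (unliftP ord0 j) => [j' ->|->].
- by move=> ij; apply: Gd; apply: contraNneq ij => ->.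
- by move=> _; split=> //; apply: contraNneq (Gint i') => ->.
- move=> _; split; last by apply/hasPn.
  by apply: contraNneq (Gint j') => <-.
- by rewrite eqxx.
Qed.

End Menger.

Local Open Scope ring_scope.

(** * Bernoulli random sets *)

Section Bernoulli.
Variables (R : realFieldType) (T : finType).
Implicit Types (p : R) (x y D : {set T}) (f g : {set T} -> R).

Definition bern_weight p x : R := \prod_(t : T) (if t \in x then p else 1 - p).

Definition bern_E p f : R := \sum_(x : {set T}) bern_weight p x * f x.

Definition merge D x y : {set T} := (x :&: D) :|: (y :\: D).

Definition depends_on D (U : Type) (f : {set T} -> U) :=
  forall x y, x :&: D = y :&: D -> f x = f y.

Lemma in_merge D x y t : (t \in merge D x y) = if t \in D then t \in x else t \in y.
Proof. by rewrite !inE; case: (t \in D); rewrite ?andbT ?andbF ?orbF. Qed.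

Lemma mergeK D x y : merge D (merge D x y) (merge D y x) = x.
Proof. by apply/setP=> t; rewrite !in_merge; case: (t \in D). Qed.

Lemma merge_setI D x y : merge D x y :&: D = x :&: D.
Proof. by apply/setP=> t; rewrite !inE; case: (t \in D); rewrite ?andbT ?andbF ?orbF. Qed.

Lemma merge_setI_disjoint D D' x y :
  [disjoint D & D'] -> merge D x y :&: D' = y :&: D'.
Proof.
move=> dis; apply/setP=> t; rewrite inE in_merge inE.
case tD: (t \in D'); last by rewrite !andbF.
by rewrite (disjointFl dis tD).
Qed.

Lemma bern_weight_ge0 p x : 0 <= p <= 1 -> 0 <= bern_weight p x.
Proof.
move=> /andP[p0 p1]; apply: prodr_ge0 => t _; case: ifP => // _.
by rewrite subr_ge0.
Qed.

Lemma bern_E_prod p (f : T -> bool -> R) :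
  bern_E p (fun x => \prod_t f t (t \in x)) =
  \prod_t (p * f t true + (1 - p) * f t false).
Proof.
rewrite bigA_distr; apply: eq_bigr => x _; rewrite -big_split /=.
by apply: eq_bigr => t _; case: ifP.
Qed.

Lemma eq_bern_E p f g : f =1 g -> bern_E p f = bern_E p g.
Proof. by move=> fg; apply: eq_bigr => x _; rewrite fg. Qed.

Lemma bern_E_cst p c : bern_E p (fun=> c) = c.
Proof.
rewrite /bern_E -mulr_suml; suff -> : \sum_(x : {set T}) bern_weight p x = 1.
  by rewrite mul1r.
transitivity (bern_E p (fun x => \prod_t (fun=> fun=> 1) t (t \in x))).
  by apply: eq_bigr => x _; rewrite big1 ?mulr1.
by rewrite (bern_E_prod p (fun=> fun=> 1)) big1 // => t _; rewrite !mulr1 addrC subrK.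
Qed.

Lemma bern_EZ p c f : bern_E p (fun x => c * f x) = c * bern_E p f.
Proof. by rewrite /bern_E mulr_sumr; apply: eq_bigr => x _; rewrite mulrCA. Qed.

Lemma bern_ED p f g : bern_E p (fun x => f x + g x) = bern_E p f + bern_E p g.
Proof. by rewrite /bern_E -big_split; apply: eq_bigr => x _; rewrite mulrDr. Qed.

Lemma bern_EB p f g : bern_E p (fun x => f x - g x) = bern_E p f - bern_E p g.
Proof.
rewrite bern_ED; congr (_ + _).
by rewrite -[RHS]mulN1r -bern_EZ; apply: eq_bern_E => x; rewrite mulN1r.
Qed.

Lemma bern_E_sum p (I : Type) (s : seq I) (Q : pred I) (F : I -> {set T} -> R) :
  bern_E p (fun x => \sum_(i <- s | Q i) F i x) =
  \sum_(i <- s | Q i) bern_E p (F i).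
Proof.
rewrite /bern_E exchange_big; apply: eq_bigr => x _ /=.
by rewrite mulr_sumr.
Qed.

Lemma ler_bern_E p f g : 0 <= p <= 1 ->
  (forall x, f x <= g x) -> bern_E p f <= bern_E p g.
Proof.
by move=> p01 fg; apply: ler_sum => x _; rewrite ler_wpM2l ?bern_weight_ge0.
Qed.

Lemma bern_E_ge0 p f : 0 <= p <= 1 -> (forall x, 0 <= f x) -> 0 <= bern_E p f.
Proof. by move=> p01 f0; rewrite -(bern_E_cst p 0); apply: ler_bern_E. Qed.

Lemma bern_weight_merge p D x y :
  bern_weight p (merge D x y) * bern_weight p (merge D y x) =
  bern_weight p x * bern_weight p y.
Proof.
rewrite /bern_weight -!big_split; apply: eq_bigr => t _ /=.
by rewrite !in_merge; case: (t \in D) => //; rewrite mulrC.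
Qed.

(* (x, y) |-> (merge D x y, merge D y x) is a weight-preserving involution. *)
Lemma bern_E_merge p D f :
  bern_E p f = bern_E p (fun x => bern_E p (fun y => f (merge D x y))).
Proof.
transitivity (\sum_(u : {set T} * {set T})
    bern_weight p u.1 * bern_weight p u.2 * f u.1).
  rewrite -(pair_bigA _ (fun x y => bern_weight p x * bern_weight p y * f x)) /=.
  apply: eq_bigr => x _; rewrite -[LHS](bern_E_cst p) /bern_E.
  by apply: eq_bigr => y _; rewrite mulrCA mulrA.
rewrite (reindex_inj (h := fun u => (merge D u.1 u.2, merge D u.2 u.1))); last first.
  by apply: (can_inj (g := fun u => (merge D u.1 u.2, merge D u.2 u.1))) => -[x y] /=;
     rewrite !mergeK.
rewrite -(pair_bigA _ (fun x y => bern_weight p (merge D x y) *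
   bern_weight p (merge D y x) * f (merge D x y))) /=.
apply: eq_bigr => x _; rewrite /bern_E mulr_sumr; apply: eq_bigr => y _.
by rewrite bern_weight_merge mulrA.
Qed.

Lemma bern_EM_indep p D D' f g : [disjoint D & D'] ->
  depends_on D f -> depends_on D' g ->
  bern_E p (fun x => f x * g x) = bern_E p f * bern_E p g.
Proof.
move=> dis fD gD; rewrite (bern_E_merge p D).
rewrite -[RHS]mulrC -bern_EZ; apply: eq_bern_E => x.
rewrite mulrC -bern_EZ; apply: eq_bern_E => y.
by rewrite (fD _ x) ?merge_setI // (gD _ y) ?merge_setI_disjoint.
Qed.

Lemma bern_E_prod_indep p (I : finType) (A : {set I}) (D : I -> {set T})
    (F : I -> {set T} -> R) :
  {in A &, forall i j, i != j -> [disjoint D i & D j]} ->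
  {in A, forall i, depends_on (D i) (F i)} ->
  bern_E p (fun x => \prod_(i in A) F i x) = \prod_(i in A) bern_E p (F i).
Proof.
move=> dis dep.
suff H s : uniq s -> {subset s <= A} ->
    bern_E p (fun x => \prod_(i <- s) F i x) = \prod_(i <- s) bern_E p (F i).
  rewrite -big_enum /= -H ?enum_uniq //; last by move=> i; rewrite mem_enum.
  by apply: eq_bern_E => x; rewrite big_enum.
elim: s => [_ _|i s IH /= /andP[iNs us] sA].
  by rewrite big_nil (eq_bern_E p (g := fun=> 1)) ?bern_E_cst // => x; rewrite big_nil.
rewrite big_cons -IH //; last by move=> j js; apply: sA; rewrite inE js orbT.
have iA : i \in A by apply: sA; rewrite inE eqxx.
rewrite -(@bern_EM_indep p (D i) (\bigcup_(j <- s) D j)).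
- by apply: eq_bern_E => x; rewrite big_cons.
- rewrite bigcup_seq; apply: bigcup_disjoint => j js.
  apply: dis => //; first by apply: sA; rewrite inE js orbT.
  by apply: contraNneq iNs => ->.
- exact: dep.
- move=> x y xy; apply: eq_big_seq => j js.
  have jA : j \in A by apply: sA; rewrite inE js orbT.
  apply: (dep j jA); apply/setP => t; move/setP/(_ t): xy; rewrite !inE.
  case tj : (t \in D j); rewrite ?andbF // !andbT.
  suff -> : t \in \bigcup_(j <- s) D j by rewrite !andbT.
  by rewrite bigcup_seq; apply/bigcupP; exists j.
Qed.

Lemma bern_E_mem p t f :
  bern_E p (fun x => (t \in x)%:R * f x) = p * bern_E p (fun x => f (t |: x)).
Proof.
rewrite (bern_E_merge p [set t]).
transitivity (bern_E p (fun x => bern_E p (fun y => f (t |: y)) * (t \in x)%:R)).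
  apply: eq_bern_E => x; rewrite mulrC -bern_EZ; apply: eq_bern_E => y.
  rewrite in_merge inE eqxx; case tx: (t \in x); rewrite ?mul0r // !mul1r.
  congr f; apply/setP => s; rewrite in_merge !inE.
  by case: (eqVneq s t) => [->|].
rewrite bern_EZ mulrC; congr (_ * _).
transitivity (bern_E p (fun x => \prod_s (fun s b => if s == t then b%:R else 1) s (s \in x))).
  by apply: eq_bern_E => x; rewrite (bigD1 t) //= eqxx big1 ?mulr1 // => s /negPf->.
rewrite (bern_E_prod p (fun s b => if s == t then b%:R else 1)) (bigD1 t) //= eqxx.
rewrite mulr1 mulr0 addr0 big1 ?mulr1 // => s /negPf->.
by rewrite !mulr1 addrC subrK.
Qed.

(** The one-coordinate case of Harris' inequality: a decreasing function is negatively correlated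
    with the presence of [t]. *)
Lemma ler_bern_E_mem p t f : 0 <= p <= 1 -> (forall x, f (t |: x) <= f x) ->
  bern_E p (fun x => (t \in x)%:R * f x) <= p * bern_E p f.
Proof.
move=> p01 ft; rewrite bern_E_mem; apply: ler_wpM2l; first by case/andP: p01.
exact: ler_bern_E.
Qed.

Lemma bern_E_exp_card p D (z : R) :
  bern_E p (fun x => z ^+ #|x :&: D|) = (1 - p + p * z) ^+ #|D|.
Proof.
transitivity (bern_E p (fun x => \prod_t
   (fun t b => if b && (t \in D) then z else 1) t (t \in x))).
  apply: eq_bern_E => x; rewrite -prodr_const big_mkcond /=.
  by apply: eq_bigr => t _; rewrite inE.
rewrite (bern_E_prod p (fun t b => if b && (t \in D) then z else 1)).
rewrite -prodr_const [RHS]big_mkcond /=; apply: eq_bigr => t _.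
by case: ifP => _; rewrite !mulr1 addrC // subrK.
Qed.

Lemma bern_E_expT p (z : R) :
  bern_E p (fun x => z ^+ #|x|) = (1 - p + p * z) ^+ #|T|.
Proof.
have := bern_E_exp_card p setT z; rewrite cardsT => <-.
by apply: eq_bern_E => x; rewrite setIT.
Qed.

(* Induction on j: E (#|x| f x) <= #|T| p E (f (t |: x)), and adding t shifts #|x| by at most one. *)
Lemma bern_E_moment_le p (z : R) (c j : nat) : 0 <= p <= 1 -> 0 <= z <= 1 ->
  bern_E p (fun x => (#|x| + c)%:R ^+ j * z ^+ #|x|) <=
  (#|T|%:R * p + (c + j)%:R) ^+ j * (1 - p + p * z) ^+ #|T|.
Proof.
move=> p01 /andP[z0 z1]; have /andP[p0 p1] := p01.
have b0 : 0 <= (1 - p + p * z) ^+ #|T|.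
  by apply: exprn_ge0; apply: addr_ge0; rewrite ?subr_ge0 ?mulr_ge0.
have Tp0 : 0 <= #|T|%:R * p by rewrite mulr_ge0.
elim: j c => [|j IH] c.
  by rewrite expr0 mul1r (eq_bern_E p (g := fun x => z ^+ #|x|)) ?bern_E_expT // => x;
     rewrite mul1r.
pose G (x : {set T}) := (#|x| + c.+1)%:R ^+ j * z ^+ #|x| : R.
have Gx t x : (fun x => (#|x| + c)%:R ^+ j * z ^+ #|x|) (t |: x) <= G x.
  rewrite /G cardsU1; apply: ler_pM; rewrite ?exprn_ge0 //.
    by rewrite lerXn2r ?nnegrE ?ler0n // ler_nat; case: (t \in x); lia.
  by apply: ler_wiXn2l => //; lia.
have H : bern_E p (fun x => #|x|%:R * ((#|x| + c)%:R ^+ j * z ^+ #|x|)) <=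
         #|T|%:R * p * bern_E p G.
  rewrite (eq_bern_E p (g := fun x => \sum_t (t \in x)%:R * ((#|x| + c)%:R ^+ j * z ^+ #|x|))).
    rewrite bern_E_sum -mulrA mulr_natl -sumr_const; apply: ler_sum => t _.
    by rewrite bern_E_mem; apply: ler_wpM2l => //; apply: ler_bern_E => // x; apply: Gx.
  move=> x; rewrite -mulr_suml; congr (_ * _).
  by rewrite -natr_sum -sum1_card big_mkcond /=; congr (_%:R); apply: eq_bigr => t _; case: ifP.
have -> : bern_E p (fun x => (#|x| + c)%:R ^+ j.+1 * z ^+ #|x|) =
   bern_E p (fun x => #|x|%:R * ((#|x| + c)%:R ^+ j * z ^+ #|x|)) +
   c%:R * bern_E p (fun x => (#|x| + c)%:R ^+ j * z ^+ #|x|).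
  by rewrite -bern_EZ -bern_ED; apply: eq_bern_E => x; rewrite exprS natrD; ring.
apply: (@le_trans _ _ (#|T|%:R * p * bern_E p G + c%:R * bern_E p G)).
  apply: lerD => //; apply: ler_wpM2l => //; apply: ler_bern_E => // x.
  by apply: ler_wpM2r; rewrite ?exprn_ge0 // lerXn2r ?nnegrE ?ler0n // ler_nat; lia.
rewrite -mulrDl.
apply: (@le_trans _ _ ((#|T|%:R * p + c%:R) * ((#|T|%:R * p + (c.+1 + j)%:R) ^+ j *
   (1 - p + p * z) ^+ #|T|))).
  by apply: ler_wpM2l (IH _); rewrite addr_ge0.
rewrite mulrA; apply: ler_wpM2r => //; rewrite addSnnS exprS.
apply: ler_wpM2r; first by rewrite exprn_ge0 ?addr_ge0.
by rewrite lerD2l ler_nat; lia.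
Qed.

End Bernoulli.

(** * Neighbourhoods in the random intersection graph *)

Section RandomIntersectionGraph.
Variables (R : realFieldType) (V O : finType) (p : R).
Hypothesis p01 : 0 <= p <= 1.
Implicit Types (X Y : {set V * O}) (A B W : {set V}) (U : {set O}).

Definition owned X A : {set O} := [set o | [exists i in A, (i, o) \in X]].

Definition rig X : rel V :=
  [rel i j | (i != j) && [exists o, ((i, o) \in X) && ((j, o) \in X)]].

Definition hits X w U := [exists o in U, (w, o) \in X].

(** Two set parameters, because [B = A] gives the outer neighbourhood of [A] and [B = [set i]] the
    neighbours of [i] outside [A]. For [B] inside [A], the objects come from the rows of [A] and the
    hits from the other rows, which are independent. *)
Definition nout X B A : {set V} := [set w | (w \notin A) && hits X w (owned X B)].

Definition rows A : {set V * O} := [set z | z.1 \in A].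

Definition inner_edge X A := [exists i in A, exists j in A, rig X i j].

Lemma bern_E_void (T : finType) (D : {set T}) :
  bern_E p (fun x => (x :&: D == set0)%:R) = (1 - p) ^+ #|D|.
Proof.
rewrite -[1 - p]addr0 -(mulr0 p) -bern_E_exp_card; apply: eq_bern_E => x.
by rewrite expr0n cards_eq0.
Qed.

Lemma hits_void X w U : hits X w U = (X :&: setX [set w] U != set0).
Proof.
apply/existsP/set0Pn => [[o /andP[oU wX]]|[[v o]]].
  by exists (w, o); rewrite !inE wX eqxx.
by rewrite !inE /= => /andP[vX /andP[/eqP <- oU]]; exists o; rewrite oU.
Qed.

Lemma owned_void X B o : (o \in owned X B) = (X :&: setX B [set o] != set0).
Proof.
rewrite inE; apply/existsP/set0Pn => [[i /andP[iB iX]]|[[v o']]].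
  by exists (i, o); rewrite !inE iX iB eqxx.
by rewrite !inE /= => /andP[vX /andP[vB /eqP <-]]; exists v; rewrite vB.
Qed.

Lemma bern_E_hits w U b :
  bern_E p (fun X => (hits X w U == b)%:R) =
  if b then 1 - (1 - p) ^+ #|U| else (1 - p) ^+ #|U|.
Proof.
have E : (1 - p) ^+ #|U| = bern_E p (fun X => (X :&: setX [set w] U == set0)%:R).
  by rewrite bern_E_void cardsX cards1 mul1n.
case: b; rewrite E; last by apply: eq_bern_E => X; rewrite hits_void eqbF_neg negbK.
rewrite -[X in X - _](@bern_E_cst R (V * O)%type p) -bern_EB; apply: eq_bern_E => X.
by rewrite hits_void eqb_id; case: eqP; rewrite ?subrr ?subr0.
Qed.

Lemma prod_indicator (I : finType) (A : {pred I}) (b : I -> bool) :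
  \prod_(i in A) (b i)%:R = [forall i in A, b i]%:R :> R.
Proof.
case: (boolP [forall i in A, b i]) => [/forall_inP h|].
  by rewrite big1 // => i iA; rewrite h.
rewrite negb_forall => /existsP[i]; rewrite negb_imply => /andP[iA /negPf bi].
by rewrite (bigD1 i) //= bi mul0r.
Qed.

(** All nodes of [B] miss a given object with probability [(1 - p) ^+ #|B|], and different objects
    read disjoint columns of [X]. *)
Lemma owned_law B (F : {set O} -> R) :
  bern_E p (fun X => F (owned X B)) = bern_E (1 - (1 - p) ^+ #|B|) F.
Proof.
transitivity (\sum_(Y : {set O}) F Y * bern_E p (fun X => (owned X B == Y)%:R)).
  under eq_bigr do rewrite -bern_EZ.
  rewrite -bern_E_sum; apply: eq_bern_E => X.
  rewrite (bigD1 (owned X B)) //= eqxx mulr1 big1 ?addr0 // => Y /negPf.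
  by rewrite eq_sym => ->; rewrite mulr0.
apply: eq_bigr => Y _; rewrite mulrC; congr (_ * _).
transitivity (bern_E p (fun X => \prod_(o in [set: O]) ((o \in owned X B) == (o \in Y))%:R)).
  apply: eq_bern_E => X; rewrite prod_indicator; congr (_%:R); congr nat_of_bool.
  apply/eqP/forall_inP => [-> //|h]; apply/setP => o; exact/eqP/h.
rewrite (bern_E_prod_indep p (D := fun o => setX setT [set o])).
- rewrite /bern_weight [LHS]big_mkcond /=; apply: eq_bigr => o _; rewrite inE.
  have E : (1 - p) ^+ #|B| = bern_E p (fun X => (X :&: setX B [set o] == set0)%:R).
    by rewrite bern_E_void cardsX cards1 muln1.
  have -> : 1 - (1 - (1 - p) ^+ #|B|) = (1 - p) ^+ #|B| by ring.
  rewrite E; case: (o \in Y); last first.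
    by apply: eq_bern_E => X; rewrite owned_void eqbF_neg negbK.
  rewrite -[X in X - _](@bern_E_cst R (V * O)%type p) -bern_EB; apply: eq_bern_E => X.
  by rewrite owned_void eqb_id; case: eqP; rewrite ?subrr ?subr0.
- move=> o o' _ _ oo'; rewrite -setI_eq0; apply/eqP/setP => -[v o2]; rewrite !inE /=.
  by apply: contraNF oo' => /andP[/eqP <- /eqP <-].
- move=> o _ X X' XX'; rewrite !owned_void; congr (((_ != set0) == _)%:R).
  have -> : setX B [set o] = setX setT [set o] :&: setX B [set o].
    by apply/setP => z; rewrite !inE /=; case: eqP; rewrite ?andbF.
  by rewrite !setIA XX'.
Qed.

Lemma owned_merge A B X X' : B \subset A -> owned (merge (rows A) X X') B = owned X B.
Proof.
move=> /subsetP BA; apply/setP => o; rewrite !inE; apply: eq_existsb => i.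
by case iB: (i \in B) => //=; rewrite in_merge inE /= BA.
Qed.

Lemma nout_merge A B X X' : B \subset A ->
  nout (merge (rows A) X X') B A = [set w | (w \notin A) && hits X' w (owned X B)].
Proof.
move=> BA; apply/setP => w; rewrite !inE owned_merge //.
case wA: (w \in A) => //=; apply: eq_existsb => o.
by rewrite in_merge [(w, o) \in rows A]in_set /= wA.
Qed.

(* The probability that j given nodes meet and m others avoid a common Bernoulli(pi) object set. *)
Definition hit_pattern (pi : R) j m : R :=
  bern_E pi (fun U : {set O} => (1 - (1 - p) ^+ #|U|) ^+ j * ((1 - p) ^+ #|U|) ^+ m).

(** The lower tail of a mixed binomial law: [N] trials with the random success probability
    [1 - (1 - p) ^+ #|U|]. *)
Definition nout_tail (pi : R) N k : R := \sum_(j < k) 'C(N, j)%:R * hit_pattern pi j (N - j).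

(** Resampling the rows outside [A] leaves the object set of [B] fixed; given that set, the nodes
    outside [A] read disjoint rows. *)
Lemma nout_eq_law A B W : B \subset A -> W \subset ~: A ->
  bern_E p (fun X => (nout X B A == W)%:R) =
  hit_pattern (1 - (1 - p) ^+ #|B|) #|W| (#|~: A| - #|W|).
Proof.
move=> BA WA; rewrite /hit_pattern -owned_law (bern_E_merge p (rows A)).
apply: eq_bern_E => X; set y := (1 - p) ^+ _.
transitivity (bern_E p (fun X' =>
    \prod_(w in ~: A) (hits X' w (owned X B) == (w \in W))%:R)).
  apply: eq_bern_E => X'; rewrite nout_merge // prod_indicator.
  congr (_%:R); congr nat_of_bool; apply/eqP/forall_inP => [<- w|h].
    by rewrite !inE => ->.
  apply/setP => w; rewrite inE; case wA: (w \in A) => /=.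
    by apply/esym/negP => /(subsetP WA); rewrite inE wA.
  have wA' : w \in ~: A by rewrite inE wA.
  exact: (eqP (h w wA')).
rewrite (bern_E_prod_indep p (D := fun w => rows [set w])).
- under eq_bigr do rewrite bern_E_hits -/y.
  rewrite (bigID (mem W)) /=; congr (_ * _).
    rewrite -prodr_const; apply: eq_big => [w|w /andP[_ ->] //].
    by case wW: (w \in W); rewrite ?andbF // (subsetP WA).
  have -> : (#|~: A| - #|W|)%N = #|~: A :\: W| by rewrite cardsD (setIidPr WA).
  rewrite -prodr_const; apply: eq_big => [w|w /andP[_ /negPf->] //].
  by rewrite !inE andbC.
- move=> w w' _ _ ww'; rewrite -setI_eq0; apply/eqP/setP => -[v o]; rewrite !inE /=.
  by apply: contraNF ww' => /andP[/eqP <- /eqP <-].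
- move=> w _ X1 X2 XX; rewrite !hits_void; congr (((_ != set0) == _)%:R).
  have -> : setX [set w] (owned X B) = rows [set w] :&: setX [set w] (owned X B).
    by apply/setP => z; rewrite !inE /=; case: eqP.
  by rewrite !setIA XX.
Qed.

Lemma nout_tail_law A B k : B \subset A ->
  bern_E p (fun X => (#|nout X B A| < k)%N%:R) = nout_tail (1 - (1 - p) ^+ #|B|) #|~: A| k.
Proof.
move=> BA; transitivity (bern_E p (fun X => \sum_(j < k)
    \sum_(W in [set W : {set V} | W \subset ~: A & #|W| == j]) (nout X B A == W)%:R)).
  apply: eq_bern_E => X.
  have sub : nout X B A \subset ~: A by apply/subsetP => w; rewrite !inE => /andP[].
  have inner (j : nat) : \sum_(W in [set W : {set V} | W \subset ~: A & #|W| == j])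
      (nout X B A == W)%:R = (#|nout X B A| == j)%:R :> R.
    have [<-|nj] := eqVneq.
      rewrite (bigD1 (nout X B A)) ?inE ?sub ?eqxx //= big1 ?addr0 // => W.
      by case/andP=> _ /negPf; rewrite eq_sym => ->.
    rewrite big1 // => W; rewrite inE => /andP[_ /eqP Wj].
    by case: eqP => // E; rewrite E Wj eqxx in nj.
  under eq_bigr do rewrite inner.
  case: ltnP => [lt|ge]; last first.
    rewrite big1 // => j _; case: eqP => // E; have := ltn_ord j.
    by rewrite -E ltnNge ge.
  rewrite (bigD1 (Ordinal lt)) //= eqxx big1 ?addr0 // => j /negPf.
  by rewrite -val_eqE /= eq_sym => ->.
rewrite bern_E_sum; apply: eq_bigr => j _; rewrite bern_E_sum.
rewrite -cards_draws mulr_natl -sumr_const; apply: eq_bigr => W.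
by rewrite inE => /andP[WA /eqP Wj]; rewrite nout_eq_law // Wj.
Qed.

(** The closed form of the probability that [m] given nodes all miss a Bernoulli([pi]) object
    set. *)
Definition void_rate (pi : R) m : R := (1 - pi + pi * (1 - p) ^+ m) ^+ #|O|.

Lemma bernoulli_ineq (x : R) n : 0 <= x <= 1 -> 1 - n%:R * x <= (1 - x) ^+ n.
Proof.
move=> /andP[x0 x1]; elim: n => [|n IH]; first by rewrite mul0r subr0 expr0.
rewrite exprS; have y0 : 0 <= 1 - x by rewrite subr_ge0.
apply: le_trans (ler_wpM2l y0 IH); have : 0 <= n%:R * x * x by rewrite !mulr_ge0.
rewrite -natr1; nra.
Qed.

(** By Bernoulli's inequality a node hits [U] with probability at most [p * #|U|], which leaves the
    weighted moment of [bern_E_moment_le]. *)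
Lemma hit_pattern_le pi j m : 0 <= pi <= 1 ->
  hit_pattern pi j m <= p ^+ j * (#|O|%:R * pi + j%:R) ^+ j * void_rate pi m.
Proof.
move=> pi01; have /andP[p0 p1] := p01; have y0 : 0 <= 1 - p by rewrite subr_ge0.
have y1 : 1 - p <= 1 by rewrite gerBl.
have z01 : 0 <= (1 - p) ^+ m <= 1 by rewrite exprn_ge0 //= exprn_ile1.
have := @bern_E_moment_le R O pi ((1 - p) ^+ m) 0 j pi01 z01; rewrite add0n => H.
rewrite -mulrA; apply: le_trans (ler_wpM2l (exprn_ge0 j p0) H).
rewrite /hit_pattern -bern_EZ; apply: ler_bern_E => // U; rewrite addn0 mulrA exprAC.
apply: ler_wpM2r; first by rewrite !exprn_ge0.
rewrite -exprMn; apply: lerXn2r; rewrite ?nnegrE ?subr_ge0 ?exprn_ile1 ?mulr_ge0 //.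
by have := bernoulli_ineq #|U| p01; rewrite [p * _]mulrC; lra.
Qed.

(** Convexity: the left side is the tangent to [t ^+ j] at [t0]. Being linear in [t], it has an
    expectation in closed form. *)
Lemma tangent_le (t t0 : R) j : 0 <= t -> 0 < t0 ->
  t0 ^+ j * (1 - j%:R + j%:R * (t / t0)) <= t ^+ j.
Proof.
move=> t_ge t0_gt; have -> : t ^+ j = t0 ^+ j * (t / t0) ^+ j.
  by rewrite -exprMn mulrCA divff ?mulr1 // gt_eqF.
apply: ler_wpM2l; first by rewrite exprn_ge0 // ltW.
set x := t / t0; have x0 : 0 <= x by rewrite divr_ge0 // ltW.
elim: j => [|j IH]; first by rewrite mul0r subr0 addr0 expr0.
rewrite exprS; apply: le_trans (ler_wpM2l x0 IH); rewrite -natr1.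
have : 0 <= j%:R * (x - 1) ^+ 2 by rewrite mulr_ge0 // sqr_ge0.
by rewrite expr2; nra.
Qed.

(** The tangent bound at [t = 1 - y] with [y = (1 - p) ^+ #|U|]; after multiplication by [y ^+ m]
    only the void probabilities for [m] and [m.+1] nodes occur. *)
Lemma hit_pattern_ge pi t0 j m : 0 <= pi <= 1 -> 0 < t0 ->
  t0 ^+ j * ((1 - j%:R) * void_rate pi m +
             j%:R * ((void_rate pi m - void_rate pi m.+1) / t0)) <= hit_pattern pi j m.
Proof.
move=> pi01 t0_gt; have /andP[p0 p1] := p01; have y0 : 0 <= 1 - p by rewrite subr_ge0.
have y1 : 1 - p <= 1 by rewrite gerBl.
have E n : void_rate pi n = bern_E pi (fun U : {set O} => ((1 - p) ^+ #|U|) ^+ n).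
  by rewrite /void_rate -bern_E_expT; apply: eq_bern_E => U; rewrite exprAC.
rewrite !E -bern_EB [_ / t0]mulrC -!bern_EZ -bern_ED -bern_EZ.
apply: ler_bern_E => // U; set y := (1 - p) ^+ #|U|.
have yy : 0 <= 1 - y by rewrite subr_ge0 exprn_ile1.
have := tangent_le j yy t0_gt.
have ym : 0 <= y ^+ m by rewrite !exprn_ge0.
move=> /(ler_wpM2r ym); apply: le_trans.
by rewrite [y ^+ m.+1]exprS le_eqVlt; apply/orP; left; apply/eqP; ring.
Qed.

Lemma sub_nout X X' B A : X \subset X' -> nout X B A \subset nout X' B A.
Proof.
move=> /subsetP XX'; apply/subsetP => w; rewrite !inE => /andP[-> /existsP[o]].
rewrite inE => /andP[/existsP[i /andP[iB iX]] wX]; apply/existsP; exists o.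
rewrite XX' // andbT inE; apply/existsP; exists i; by rewrite iB XX'.
Qed.

Lemma nout_lt_mono X X' B A k : X \subset X' ->
  (#|nout X' B A| < k)%N%:R <= (#|nout X B A| < k)%N%:R :> R.
Proof.
move=> /(sub_nout B A) /subset_leq_card le; rewrite ler_nat.
by case: ltnP => // lt; rewrite (leq_ltn_trans le lt).
Qed.

Lemma inner_edge_le A (f : {set V * O} -> R) : (forall X, 0 <= f X) ->
  (forall t X, f (t |: X) <= f X) ->
  bern_E p (fun X => (inner_edge X A)%:R * f X) <=
  (#|A| ^ 2)%:R * #|O|%:R * p ^+ 2 * bern_E p f.
Proof.
move=> f0 fmono; have /andP[p0 _] := p01.
apply: (@le_trans _ _ (bern_E p (fun X => \sum_(i in A) \sum_(j in A | j != i) \sum_(o in O)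
   ((i, o) \in X)%:R * (((j, o) \in X)%:R * f X)))).
  apply: ler_bern_E => // X.
  have t0 i j : 0 <= \sum_(o in O) ((i, o) \in X)%:R * (((j, o) \in X)%:R * f X) :> R.
    by apply: sumr_ge0 => o _; rewrite !mulr_ge0.
  have s0 i : 0 <= \sum_(j in A | j != i) \sum_(o in O)
    ((i, o) \in X)%:R * (((j, o) \in X)%:R * f X) :> R by apply: sumr_ge0.
  case: (boolP (inner_edge X A)) => [|_]; last by rewrite mul0r; apply: sumr_ge0.
  case/existsP=> i /andP[iA /existsP[j /andP[jA /andP[ij /existsP[o /andP[io jo]]]]]].
  rewrite (bigD1 i) //= (bigD1 j) /=; last by rewrite jA eq_sym.
  rewrite (bigD1 o) //= io jo !mul1r -!addrA lerDl.
  rewrite !addr_ge0 //; apply: sumr_ge0 => // *; by rewrite !mulr_ge0.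
rewrite bern_E_sum.
have -> : (#|A| ^ 2)%:R * #|O|%:R * p ^+ 2 * bern_E p f =
  \sum_(i in A) \sum_(j in A) \sum_(o in O) p ^+ 2 * bern_E p f.
  by rewrite !sumr_const -!mulrnA -[RHS]mulr_natr -mulnn !natrM; ring.
apply: ler_sum => i iA; rewrite bern_E_sum [leRHS](bigID (fun j => j != i)) /=.
apply: ler_wpDr.
  by apply: sumr_ge0 => j _; apply: sumr_ge0 => o _; rewrite mulr_ge0 ?exprn_ge0 ?bern_E_ge0.
apply: ler_sum => j /andP[jA ji]; rewrite bern_E_sum; apply: ler_sum => o _.
(* Each of the entries [(i, o)] and [(j, o)] costs a factor [p]. Since [j != i], adding [(i, o)]
   leaves the indicator of [(j, o)] unchanged, so the remaining function still decreases in that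
   entry. *)
rewrite expr2 -mulrA; apply: le_trans (ler_wpM2l p0 (ler_bern_E_mem p01 (fmono (j, o)))).
apply: ler_bern_E_mem => // X; rewrite in_setU1 xpair_eqE (negPf ji) /=.
by apply: ler_wpM2l.
Qed.

(** * Joint law of low degrees in a set of nodes *)

Definition all_bad k X A := [forall i in A, #|[set w | rig X i w]| < k]%N.

Lemma nbrs_nout X A : nbrs (rig X) A = nout X A A.
Proof.
apply/setP => w; rewrite !inE; case wA: (w \in A) => //=.
apply/existsP/existsP => [[i /andP[iA /andP[_ /existsP[o /andP[io wo]]]]]|[o]].
  by exists o; rewrite wo andbT inE; apply/existsP; exists i; rewrite iA.
rewrite inE => /andP[/existsP[i /andP[iA io]] wo]; exists i; rewrite iA /=.
apply/andP; split; first by apply: contraFneq wA => <-.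
by apply/existsP; exists o; rewrite io.
Qed.

Lemma nout1_sub X A i : i \in A -> nout X [set i] A \subset [set w | rig X i w].
Proof.
move=> iA; apply/subsetP => w; rewrite !inE => /andP[wA /existsP[o]].
rewrite inE => /andP[/existsP[j /andP[]]]; rewrite inE => /eqP -> io wo.
apply/andP; split; first by apply: contraNneq wA => <-.
by apply/existsP; exists o; rewrite io.
Qed.

Lemma nout1_deg X A i : i \in A -> ~~ inner_edge X A ->
  nout X [set i] A = [set w | rig X i w].
Proof.
move=> iA nin; apply/eqP; rewrite eqEsubset nout1_sub //=; apply/subsetP => w.
rewrite !inE => /andP[iw /existsP[o /andP[io wo]]].
apply/andP; split; last first.
  apply/existsP; exists o; rewrite wo andbT inE; apply/existsP; exists i.
  by rewrite inE eqxx.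
apply: contra nin => wA; apply/existsP; exists i; rewrite iA; apply/existsP; exists w.
by rewrite wA /rig /= iw; apply/existsP; exists o; rewrite io.
Qed.

Lemma all_bad_nout k X A : (0 < k)%N -> all_bad k X A -> (#|nout X A A| < #|A| * k.-1 + 1)%N.
Proof.
move=> k0 /forall_inP bad; rewrite addn1 ltnS.
apply: (@leq_trans #|\bigcup_(i in A) [set w | rig X i w]|).
  apply/subset_leq_card/subsetP => w; rewrite -nbrs_nout inE.
  by case/andP=> wA /existsP[i /andP[iA iw]]; apply/bigcupP; exists i; rewrite ?inE.
rewrite -sum_nat_const; elim/big_ind2: _ => [|a b c d ab cd|i iA]; first by rewrite cards0.
  by apply: leq_trans (leq_card_setU _ _) _; apply: leq_add.
by have := bad i iA; case: (k) k0.
Qed.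

Lemma inner_merge A X X' : inner_edge (merge (rows A) X X') A = inner_edge X A.
Proof.
apply: eq_existsb => i; case iA: (i \in A) => //=; apply: eq_existsb => j.
case jA: (j \in A) => //=; congr (_ && _); apply: eq_existsb => o.
by rewrite !in_merge !inE /= iA jA.
Qed.

Let b k A i X : R := (#|nout X [set i] A| < k)%N%:R.
(** The conditional expectation of [b] given the rows of [A]. For [i] in [A] it depends on row [i]
    alone, and it decreases in [X]; so a product over [A] factorises and also obeys the edge
    bound. *)
Let h k A i X : R := bern_E p (fun X' => b k A i (merge (rows A) X X')).

Let h0 k A i X : 0 <= h k A i X.
Proof. by apply: bern_E_ge0. Qed.

Let hmono k A i t X : h k A i (t |: X) <= h k A i X.
Proof.
apply: ler_bern_E => // X'; apply: nout_lt_mono; apply/subsetP => z.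
by rewrite !in_merge; case: ifP => // _; rewrite inE orbC => ->.
Qed.

Let hind k A i : i \in A -> depends_on (rows [set i]) (h k A i).
Proof.
move=> iA X X' XX'; apply: eq_bern_E => X2; congr ((_ < k)%N%:R).
rewrite !nout_merge ?sub1set //; congr #|pred_of_set _|; apply/setP => w; rewrite !inE.
congr (_ && hits _ _ _); apply/setP => o; rewrite !inE; apply: eq_existsb => j.
rewrite inE; case: eqP => // ->; move/setP/(_ (i, o)): XX'.
by rewrite !inE /= eqxx !andbT.
Qed.

(* Given no edge inside A the object sets of A are disjoint, so the outside degrees are
   conditionally independent. *)
Let isolated_prod k A :
  bern_E p (fun X => (~~ inner_edge X A)%:R * \prod_(i in A) b k A i X) =
  bern_E p (fun X => (~~ inner_edge X A)%:R * \prod_(i in A) h k A i X).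
Proof.
rewrite (bern_E_merge p (rows A)); apply: eq_bern_E => X.
rewrite (eq_bern_E p (g := fun X' => (~~ inner_edge X A)%:R *
   \prod_(i in A) b k A i (merge (rows A) X X'))); last by move=> X'; rewrite inner_merge.
rewrite bern_EZ; case: (boolP (inner_edge X A)) => [|nin]; first by rewrite !mul0r.
congr (_ * _).
(* Given the rows of [A], the outside degree of [i] reads only the entries of outside nodes at
   objects owned by [i]. These blocks are disjoint, as no two nodes of [A] share an object. *)
rewrite (bern_E_prod_indep p (D := fun i => setX (~: A) (owned X [set i]))) //.
  move=> i j iA jA ij; rewrite -setI_eq0; apply/eqP/setP => -[w o]; rewrite !inE /=.
  apply: contraNF nin => /andP[/andP[_ /existsP[i']]]; rewrite inE.
  move=> /andP[/eqP-> io] /andP[_ /existsP[j']]; rewrite inE => /andP[/eqP-> jo].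
  apply/existsP; exists i; rewrite iA; apply/existsP; exists j; rewrite jA /rig /= ij.
  by apply/existsP; exists o; rewrite io jo.
move=> i iA X1 X2 XX; congr ((_ < k)%N%:R).
rewrite !nout_merge ?sub1set //; congr #|pred_of_set _|; apply/setP => w; rewrite !inE.
case wA: (w \in A) => //=; apply: eq_existsb => o.
case oo: (o \in owned X [set i]) => //=.
by move/setP/(_ (w, o)): XX; rewrite !in_setI in_setX inE wA oo !andbT.
Qed.

Let h_prod k A :
  bern_E p (fun X => \prod_(i in A) h k A i X) = nout_tail p #|~: A| k ^+ #|A|.
Proof.
rewrite (bern_E_prod_indep p (D := fun i => rows [set i])); last exact: hind.
  rewrite -prodr_const; apply: eq_bigr => i iA.
  rewrite /h -bern_E_merge /b nout_tail_law ?sub1set //.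
  by rewrite cards1 expr1 opprB addrC subrK.
move=> i j _ _ ij; rewrite -setI_eq0; apply/eqP/setP => -[w o]; rewrite !inE /=.
by apply: contraNF ij => /andP[/eqP<- /eqP<-].
Qed.

Let prod_b k A X : ~~ inner_edge X A -> \prod_(i in A) b k A i X = (all_bad k X A)%:R.
Proof.
move=> nin; rewrite /b prod_indicator; congr (_%:R); congr nat_of_bool.
apply: eq_forallb => i; case iA: (i \in A) => //=; by rewrite nout1_deg.
Qed.

(** Without the no-edge indicator the product of the [h] has expectation an exact power of
    [nout_tail]; the part with an inner edge is subtracted at the price set by [inner_edge_le]. *)
Lemma all_bad_ge k A :
  (1 - (#|A| ^ 2)%:R * #|O|%:R * p ^+ 2) * nout_tail p #|~: A| k ^+ #|A| <=
  bern_E p (fun X => (all_bad k X A)%:R).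
Proof.
apply: (@le_trans _ _ (bern_E p (fun X => (~~ inner_edge X A)%:R * \prod_(i in A) b k A i X))).
  rewrite isolated_prod mulrBl mul1r -h_prod.
  rewrite [leRHS](eq_bern_E p (g := fun X => \prod_(i in A) h k A i X -
      (inner_edge X A)%:R * \prod_(i in A) h k A i X)); last first.
    by move=> X; case: (inner_edge X A); rewrite ?mul0r ?mul1r ?subrr ?subr0.
  rewrite bern_EB lerD2l lerN2; apply: inner_edge_le => [X|t X].
    by apply: prodr_ge0.
  by apply: ler_prod => i _; rewrite h0 hmono.
apply: ler_bern_E => // X; case: (boolP (inner_edge X A)) => [_|nin].
  by rewrite mul0r.
by rewrite mul1r prod_b.
Qed.

(** With an inner edge independence fails, and the event is relaxed to [A] having at most
    [#|A| * k.-1] outer neighbours. This event is decreasing, so the edge still costs its factor. *)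
Lemma all_bad_le k A : (0 < k)%N ->
  bern_E p (fun X => (all_bad k X A)%:R) <=
  nout_tail p #|~: A| k ^+ #|A| + (#|A| ^ 2)%:R * #|O|%:R * p ^+ 2 *
    nout_tail (1 - (1 - p) ^+ #|A|) #|~: A| (#|A| * k.-1 + 1).
Proof.
move=> k0; apply: (@le_trans _ _ (bern_E p (fun X =>
    (~~ inner_edge X A)%:R * \prod_(i in A) b k A i X +
    (inner_edge X A)%:R * (#|nout X A A| < #|A| * k.-1 + 1)%N%:R))).
  apply: ler_bern_E => // X; case: (boolP (inner_edge X A)) => [_|nin].
    rewrite mul0r mul1r add0r ler_nat; case: (boolP (all_bad k X A)) => // /(all_bad_nout k0) -> //.
  by rewrite mul0r mul1r addr0 prod_b.
rewrite bern_ED; apply: lerD.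
  rewrite isolated_prod -h_prod; apply: ler_bern_E => // X.
  rewrite ler_piMl ?prodr_ge0 //; by case: (inner_edge X A).
rewrite -nout_tail_law //; apply: inner_edge_le => // t X.
by apply: nout_lt_mono; apply: subsetUr.
Qed.

Lemma inner_nout_le A k :
  bern_E p (fun X => (inner_edge X A && (#|nout X A A| < k)%N)%:R) <=
  (#|A| ^ 2)%:R * #|O|%:R * p ^+ 2 * nout_tail (1 - (1 - p) ^+ #|A|) #|~: A| k.
Proof.
rewrite -nout_tail_law //.
rewrite (eq_bern_E p (g := fun X => (inner_edge X A)%:R * (#|nout X A A| < k)%N%:R)).
  apply: inner_edge_le => // t X; by apply: nout_lt_mono; apply: subsetUr.
by move=> X; rewrite -natrM mulnb.
Qed.

End RandomIntersectionGraph.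

(** * Truncated inclusion-exclusion *)

Section Bonferroni.
Variable R : realFieldType.

(** Pascal's rule telescopes the truncated sum; its sign decides on which side of the indicator of
    zero the truncation lies. *)
Lemma alternating_binomial (x m : nat) :
  \sum_(r < m.+1) (-1) ^+ r * 'C(x.+1, r)%:R = (-1) ^+ m * 'C(x, m)%:R :> R.
Proof.
elim: m => [|m IH]; first by rewrite big_ord_recl big_ord0 !bin0 addr0.
rewrite big_ord_recr /= IH binS natrD exprS; ring.
Qed.

Lemma bonferroni_even x m : (x == 0%N)%:R <= \sum_(r < m.*2.+1) (-1) ^+ r * 'C(x, r)%:R :> R.
Proof.
case: x => [|x]; last first.
  by rewrite alternating_binomial -mul2n exprM sqrrN expr1n expr1n mul1r.
by rewrite big_ord_recl /= big1 ?addr0 ?mulr1 // => i _; rewrite bin0n mulr0.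
Qed.

Lemma bonferroni_odd x m : \sum_(r < m.*2.+2) (-1) ^+ r * 'C(x, r)%:R <= (x == 0%N)%:R :> R.
Proof.
case: x => [|x]; last first.
  by rewrite alternating_binomial exprS -mul2n exprM sqrrN expr1n expr1n mulr1 mulN1r oppr_le0.
by rewrite big_ord_recl /= big1 ?addr0 ?mulr1 // => i _; rewrite bin0n mulr0.
Qed.

End Bonferroni.

Section Monotonicity.
Variables (R : realFieldType) (T : finType).

(** Thinning: keeping each element of a Bernoulli([p]) set with probability [t] gives a
    Bernoulli([p * t]) set, which couples two values of the parameter. *)
Lemma bern_E_inter (p t : R) (f : {set T} -> R) :
  bern_E (p * t) f = bern_E p (fun x => bern_E t (fun y => f (x :&: y))).
Proof.
pose g z s (c d : bool) : R := ((c && d) == (s \in (z : {set T})))%:R.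
have fE x y : f (x :&: y) = \sum_z f z * \prod_s g z s (s \in x) (s \in y).
  have prodE z : \prod_s g z s (s \in x) (s \in y) = (x :&: y == z)%:R.
    have [<-|/eqP neq] := eqVneq; first by rewrite big1 // => s _; rewrite /g inE eqxx.
    have /existsP[s hs] : [exists s, (s \in x :&: y) != (s \in z)].
      rewrite -negb_forall; apply/negP => /forallP h; apply: neq; apply/setP => s.
      exact/eqP.
    by rewrite (bigD1 s) //= /g -in_setI (negPf hs) mul0r.
  rewrite (bigD1 (x :&: y)) //= prodE eqxx mulr1 big1 ?addr0 // => z /negPf.
  by rewrite prodE eq_sym => ->; rewrite mulr0.
transitivity (\sum_z f z * bern_weight (p * t) z); first by apply: eq_bigr => z _; rewrite mulrC.
transitivity (\sum_z f z * bern_E p (fun x => bern_E t (fun y =>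
    \prod_s g z s (s \in x) (s \in y)))); last first.
  under eq_bigr do rewrite -bern_EZ; rewrite -bern_E_sum; apply: eq_bern_E => x.
  under eq_bigr do rewrite -bern_EZ; rewrite -bern_E_sum; apply: eq_bern_E => y.
  by rewrite fE.
apply: eq_bigr => z _; congr (_ * _).
transitivity (bern_E p (fun x => \prod_s
    (fun s c => t * g z s c true + (1 - t) * g z s c false) s (s \in x))); last first.
  by apply: eq_bern_E => x; rewrite -(bern_E_prod t (fun s => g z s (s \in x))).
rewrite (bern_E_prod p (fun s c => t * g z s c true + (1 - t) * g z s c false)).
apply: eq_bigr => s _; rewrite /g /=.
by case: (s \in z) => /=; ring.
Qed.

Lemma bern_E_mono (p p' : R) (f : {set T} -> R) : 0 <= p -> p <= p' -> p' <= 1 ->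
  (forall x y : {set T}, x \subset y -> f x <= f y) -> bern_E p f <= bern_E p' f.
Proof.
move=> p0 pp' p1 fm; have [p'0|p'0] := eqVneq p' 0.
  by have -> : p = p' by apply/eqP; rewrite eq_le pp' p'0 p0.
have p'gt : 0 < p' by rewrite lt_def p'0 (le_trans p0).
have -> : p = p' * (p / p') by rewrite mulrCA divff ?mulr1.
rewrite bern_E_inter; apply: ler_bern_E => [|x]; first by rewrite ltW.
rewrite -[leRHS](bern_E_cst T (p / p')); apply: ler_bern_E => [|y].
  by rewrite ler_pdivrMr // mul1r pp' andbT divr_ge0 // ltW.
by apply: fm; apply: subsetIl.
Qed.

End Monotonicity.

Lemma sum_by_card (R : realFieldType) (V : finType) (P : pred nat) (g : nat -> R) :
  \sum_(A : {set V} | P #|A|) g #|A| = \sum_(a < #|V|.+1 | P a) 'C(#|V|, a)%:R * g a.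
Proof.
rewrite (partition_big (fun A : {set V} => inord #|A| : 'I_#|V|.+1) (fun a => P a)) /=.
  apply: eq_bigr => a Pa; rewrite -[X in 'C(X, _)]cardsT -cards_draws mulr_natl -sumr_const.
  have Va (A : {set V}) : (inord #|A| == a) = (#|A| == a).
    by rewrite -val_eqE /= inordK // ltnS max_card.
  apply: eq_big => [A|A /andP[_]]; last by rewrite Va => /eqP->.
  by rewrite Va inE subsetT /= andbC; case: eqP => // ->; rewrite Pa.
by move=> A PA; rewrite inordK // ltnS max_card.
Qed.

(** * Minimum degree versus connectivity *)

Section Connectivity.
Variables (R : realFieldType) (V O : finType) (p : R) (k : nat).
Hypotheses (p01 : 0 <= p <= 1) (V_gt1 : (1 < #|V|)%N).
Implicit Types (X : {set V * O}) (A : {set V}).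

Definition bad_nodes X : {set V} := [set i | #|[set w | rig X i w]| < k]%N.

Definition conn_prob : R := bern_E p (fun X => `[< k_connected (rig X) k >]%:R).

Definition mindeg_prob : R := bern_E p (fun X => (#|bad_nodes X| == 0)%N%:R).

Definition bad_moment r : R :=
  \sum_(A : {set V} | #|A| == r) bern_E p (fun X => (all_bad k X A)%:R).

Lemma bad_moment_bin X r :
  \sum_(A : {set V} | #|A| == r) (all_bad k X A)%:R = 'C(#|bad_nodes X|, r)%:R :> R.
Proof.
rewrite -cards_draws -sum1_card natr_sum [RHS]big_mkcond [LHS]big_mkcond /=.
apply: eq_bigr => A _; rewrite inE andbC; case: eqP => //= _.
have -> : (A \subset bad_nodes X) = all_bad k X A.
  by apply/subsetP/forall_inP => h i /h; rewrite inE.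
by case: ifP.
Qed.

Lemma mindeg_le m : mindeg_prob <= \sum_(r < m.*2.+1) (-1) ^+ r * bad_moment r.
Proof.
apply: le_trans (ler_bern_E p01 (fun X => bonferroni_even R #|bad_nodes X| m)) _.
rewrite bern_E_sum; apply: ler_sum => r _; rewrite bern_EZ /bad_moment -bern_E_sum.
by rewrite le_eqVlt; apply/orP; left; apply/eqP; congr (_ * _); apply: eq_bern_E => X;
   rewrite bad_moment_bin.
Qed.

Lemma mindeg_ge m : \sum_(r < m.*2.+2) (-1) ^+ r * bad_moment r <= mindeg_prob.
Proof.
apply: le_trans (ler_bern_E p01 (fun X => bonferroni_odd R #|bad_nodes X| m)).
rewrite bern_E_sum; apply: ler_sum => r _; rewrite bern_EZ /bad_moment -bern_E_sum.
by rewrite le_eqVlt; apply/orP; left; apply/eqP; congr (_ * _); apply: eq_bern_E => X;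
   rewrite bad_moment_bin.
Qed.

Lemma conn_le_mindeg : conn_prob <= mindeg_prob.
Proof.
apply: ler_bern_E => // X; rewrite ler_nat; case: asboolP => // kc.
rewrite lt0b cards_eq0; apply/eqP/setP => u; rewrite !inE ltnNge.
have [v uv] : exists v, u != v.
  have /card_gt1P[x [y [_ _ xy]]] := V_gt1.
  by have [ux|] := eqVneq u x; [exists y; rewrite ux|exists x].
by rewrite (connected_min_degree uv kc).
Qed.

Lemma rig_sym X : symmetric (rig X).
Proof.
by move=> i j; rewrite /rig /= eq_sym; congr (_ && _); apply: eq_existsb => o; rewrite andbC.
Qed.

Lemma mindeg_le_conn (g : nat -> R) :
  (forall A, (2 <= #|A|)%N -> (2 * #|A| <= #|V|)%N ->
     bern_E p (fun X => (inner_edge X A && (#|nout X A A| < k)%N)%:R) <= g #|A|) ->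
  mindeg_prob <= conn_prob +
    \sum_(a < #|V|.+1 | (2 <= a)%N && (2 * a <= #|V|)%N) 'C(#|V|, a)%:R * g a.
Proof.
move=> hg; rewrite -(sum_by_card V (fun a => (2 <= a)%N && (2 * a <= #|V|)%N)).
apply: (@le_trans _ _ (conn_prob + \sum_(A : {set V} | (2 <= #|A|)%N && (2 * #|A| <= #|V|)%N)
   bern_E p (fun X => (inner_edge X A && (#|nout X A A| < k)%N)%:R))); last first.
  by rewrite lerD2l; apply: ler_sum => A /andP[]; exact: hg.
rewrite -bern_E_sum -bern_ED; apply: ler_bern_E => // X.
case: asboolP => [_|nkc].
  by apply: ler_wpDr; [apply: sumr_ge0|rewrite ler_nat leq_b1].
rewrite add0r; case: (boolP (#|bad_nodes X| == 0)%N) => [|_]; last exact: sumr_ge0.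
rewrite cards_eq0 => /eqP nobad.
have deg u : (k <= #|[set w | rig X u w]|)%N.
  by move/setP/(_ u): nobad; rewrite !inE ltnNge => /negbFE.
have [A [A0 A2 Ak]] : exists A : {set V}, [/\ (0 < #|A|)%N, (2 * #|A| <= #|V|)%N &
    (#|nout X A A| < k)%N].
  apply: contrapT => nA; apply: nkc; apply: expansion_k_connected (rig_sym X) _ => A A0 A2.
  rewrite nbrs_nout leqNgt; apply/negP => Ak; apply: nA; by exists A.
have [u uA] : exists u, u \in A by apply/set0Pn; rewrite -card_gt0.
(* A node of [A] has at least [k] neighbours, and fewer than [k] of them lie outside [A]. *)
have inn : inner_edge X A.
  apply: contraLR (deg u) => nin; rewrite -ltnNge -(nout1_deg uA nin).
  apply: leq_ltn_trans Ak; apply/subset_leq_card/subsetP => w; rewrite !inE.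
  case/andP=> -> /existsP[o]; rewrite inE => /andP[/existsP[i /andP[]]].
  rewrite inE => /eqP-> uo wo; apply/existsP; exists o; rewrite wo andbT inE.
  by apply/existsP; exists u; rewrite uA.
have A1 : (2 <= #|A|)%N.
  case/existsP: inn => i /andP[iA /existsP[j /andP[jA /andP[ij _]]]].
  by apply/card_gt1P; exists i, j.
rewrite (bigD1 A) /=; last by rewrite A1 A2.
by rewrite inn Ak lerDl; apply: sumr_ge0.
Qed.

Lemma sub_k_connected (T : finType) (e e' : rel T) :
  subrel e e' -> k_connected e k -> k_connected e' k.
Proof.
move=> ee' kc u v uv; have [s [sp sd]] := kc u v uv; exists s; split=> // i.
by have [ps ls us] := sp i; split=> //; apply: sub_path ps.
Qed.

End Connectivity.

Lemma conn_prob_mono (R : realFieldType) (V O : finType) (p p' : R) k :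
  0 <= p -> p <= p' -> p' <= 1 -> conn_prob V O p k <= conn_prob V O p' k.
Proof.
move=> p0 pp' p1; apply: bern_E_mono => // X Y /subsetP XY; rewrite ler_nat.
case: asboolP => // kc; rewrite lt0b; apply/asboolP; apply: sub_k_connected kc => i j.
by case/andP=> ij /existsP[o /andP[io jo]]; rewrite /rig /= ij; apply/existsP; exists o;
   rewrite !XY.
Qed.

From mathcomp Require Import all_classical all_reals all_analysis.

Import numFieldNormedType.Exports.

(** * Estimates for fixed n *)

Section Estimates.
Variable R : realType.

Lemma pow_1B_le (x : R) m : 0 <= x <= 1 -> (1 - x) ^+ m <= 1 - m%:R * x + (m%:R * x) ^+ 2.
Proof.
move=> /andP[x0 x1]; elim: m => [|m IH]; first by rewrite expr0 mul0r subr0 expr0n addr0.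
have y0 : 0 <= 1 - x by rewrite subr_ge0.
rewrite exprS; apply: le_trans (ler_wpM2l y0 IH) _; rewrite -natr1.
have mx : 0 <= m%:R :> R by [].
have : 0 <= x * x * (m%:R * m%:R * x + m%:R + 1) by rewrite !mulr_ge0 ?addr_ge0 ?mulr_ge0.
rewrite !expr2; nra.
Qed.

Lemma expR_natl (x : R) n : expR x ^+ n = expR (n%:R * x).
Proof. by rewrite expRM_natl. Qed.

Lemma bin_le_expn N j : 'C(N, j)%:R * j`!%:R <= N%:R ^+ j :> R.
Proof.
rewrite -natrM bin_ffact -natrX ler_nat.
elim: j => [|j IH]; first by rewrite ffactn0 expn0.
by rewrite ffactnSr expnSr leq_mul // leq_subr.
Qed.

Lemma bin_ge_expn N j : (N - j)%N%:R ^+ j <= 'C(N, j)%:R * j`!%:R :> R.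
Proof.
rewrite -natrM bin_ffact -natrX ler_nat.
elim: j => [|j IH]; first by rewrite ffactn0 expn0.
rewrite ffactnSr expnSr; apply: leq_mul; last by lia.
by apply: leq_trans IH; case: j => // j; rewrite leq_exp2r //; lia.
Qed.

Variables (n m : nat) (p : R).
Hypotheses (n_gt0 : (0 < n)%N) (p01 : 0 <= p <= 1) (np1 : n%:R * p <= 1).
Let lam : R := n%:R * (p ^+ 2 * m%:R).
Let eps : R := n%:R * p.

Let p0 : 0 <= p. Proof. by case/andP: p01. Qed.
Let n0 : 0 < n%:R :> R. Proof. by rewrite ltr0n. Qed.
Let eps0 : 0 <= eps. Proof. by rewrite mulr_ge0. Qed.
Let lam0 : 0 <= lam. Proof. by rewrite !mulr_ge0 ?exprn_ge0. Qed.

Lemma hit_prob_ge a : (a <= n)%N -> a%:R * p * (1 - eps) <= 1 - (1 - p) ^+ a.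
Proof.
move=> an; have := pow_1B_le a p01; rewrite expr2.
have : a%:R <= n%:R :> R by rewrite ler_nat.
have a0 : 0 <= a%:R :> R by [].
move=> an' H; have : a%:R * p * (a%:R * p) <= a%:R * p * (n%:R * p).
  by apply: ler_wpM2l; rewrite ?mulr_ge0 // ler_wpM2r.
rewrite /eps; lra.
Qed.

Lemma hit_prob_01 a : 0 <= 1 - (1 - p) ^+ a <= 1.
Proof.
have /andP[_ p1] := p01.
by rewrite subr_ge0 exprn_ile1 ?subr_ge0 ?gerBl //= exprn_ge0 ?subr_ge0.
Qed.

Lemma hit_prob_le a : 1 - (1 - p) ^+ a <= a%:R * p.
Proof. by have := bernoulli_ineq a p01; lra. Qed.

Lemma void_rate_ge0 (pi : R) M : 0 <= pi <= 1 -> 0 <= void_rate 'I_m p pi M.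
Proof.
move=> /andP[pi0 pi1]; have /andP[_ p1] := p01.
by rewrite exprn_ge0 // addr_ge0 ?mulr_ge0 ?exprn_ge0 ?subr_ge0.
Qed.

(** Apply [1 - x <= expR (- x)] to the product of two hit probabilities; bounding each below by
    [hit_prob_ge] costs a factor [1 - eps], hence the square. *)
Lemma void_rate_le a M : (a <= n)%N -> (M <= n)%N ->
  void_rate 'I_m p (1 - (1 - p) ^+ a) M <=
  expR (- (a%:R * lam * (M%:R / n%:R) * (1 - eps) ^+ 2)).
Proof.
move=> an Mn; rewrite /void_rate card_ord.
set pi := 1 - (1 - p) ^+ a; set z := 1 - (1 - p) ^+ M.
have -> : 1 - pi + pi * (1 - p) ^+ M = 1 - pi * z by rewrite /z; ring.
have /andP[pi0 pi1] : 0 <= pi <= 1 := hit_prob_01 a.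
have /andP[z0 z1] : 0 <= z <= 1 := hit_prob_01 M.
have le1 : 1 - pi * z <= expR (- (pi * z)) by apply: expR_ge1Dx.
have ge0 : 0 <= 1 - pi * z by rewrite subr_ge0 mulr_ile1.
apply: le_trans (lerXn2r m ge0 _ le1) _; first by rewrite nnegrE expR_ge0.
rewrite expR_natl ler_expR mulrN lerN2.
have e1 : 0 <= 1 - eps by rewrite subr_ge0.
have H : a%:R * p * (1 - eps) * (M%:R * p * (1 - eps)) <= pi * z.
  by apply: ler_pM; rewrite ?mulr_ge0 ?hit_prob_ge.
apply: le_trans (ler_wpM2l (ler0n _ m) H); rewrite /lam le_eqVlt; apply/orP; left; apply/eqP.
by field; rewrite gt_eqF.
Qed.

(** Uses [1 - x >= expR (- (x / (1 - x)))] at [x = p * z]; since [z <= eps], the product [m * p * z]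
    is at most [lam]. *)
Lemma void_rate_ge M : eps < 1 -> (M <= n)%N ->
  expR (- (lam / (1 - eps))) <= void_rate 'I_m p p M.
Proof.
move=> e1 Mn; rewrite /void_rate card_ord; set z := 1 - (1 - p) ^+ M.
have -> : 1 - p + p * (1 - p) ^+ M = 1 - p * z by rewrite /z; ring.
have /andP[z0 z1] : 0 <= z <= 1 := hit_prob_01 M.
have ze : z <= eps.
  apply: le_trans (hit_prob_le M) _; by apply: ler_wpM2r => //; rewrite ler_nat.
have /andP[_ p1] := p01.
have pz : p * z <= eps by apply: le_trans ze; rewrite ler_piMl.
have d0 : 0 < 1 - p * z by lra.
have H : expR (- (p * z / (1 - p * z))) <= 1 - p * z.
  rewrite expRN -[leRHS]invrK lef_pV2 ?posrE ?expR_gt0 ?invr_gt0 //.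
  apply: le_trans (expR_ge1Dx _); rewrite le_eqVlt; apply/orP; left; apply/eqP.
  by field; rewrite gt_eqF.
have : expR (- (p * z / (1 - p * z))) ^+ m <= (1 - p * z) ^+ m.
  by apply: lerXn2r => //; rewrite nnegrE ?expR_ge0 // ltW.
apply: le_trans; rewrite expR_natl ler_expR mulrN lerN2 mulrA.
have e1' : 0 < 1 - eps by rewrite subr_gt0.
apply: ler_pM; [by rewrite !mulr_ge0|by rewrite invr_ge0 ltW| |].
  have : m%:R * p * z <= m%:R * p * eps by apply: ler_wpM2l => //; rewrite mulr_ge0.
  by rewrite mulrA /lam /eps expr2; lra.
by rewrite lef_pV2 ?posrE // lerD2l lerN2.
Qed.

Lemma nout_tail_le a N K : (a <= n)%N -> (N <= n)%N ->
  nout_tail 'I_m p (1 - (1 - p) ^+ a) N K <=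
  \sum_(j < K) (a%:R * lam + j%:R * eps) ^+ j / j`!%:R *
     expR (- (a%:R * lam * ((N%:R - j%:R) / n%:R) * (1 - eps) ^+ 2)).
Proof.
move=> an Nn; apply: ler_sum => j _; have /andP[pi0 pi1] := hit_prob_01 a.
apply: le_trans (ler_wpM2l (ler0n _ _) (hit_pattern_le 'I_m p01 j (N - j) (hit_prob_01 a))) _.
rewrite mulrA; apply: ler_pM.
- by rewrite mulr_ge0 // mulr_ge0 ?exprn_ge0 // addr_ge0 // mulr_ge0.
- exact: void_rate_ge0 (hit_prob_01 a).
- rewrite card_ord ler_pdivlMr ?ltr0n ?fact_gt0 // mulrAC.
  have e0 : 0 <= p ^+ j * (m%:R * (1 - (1 - p) ^+ a) + j%:R) ^+ j.
    by rewrite mulr_ge0 ?exprn_ge0 ?addr_ge0 ?mulr_ge0.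
  apply: le_trans (ler_wpM2r e0 (bin_le_expn N j)) _.
  rewrite -!exprMn; apply: lerXn2r; rewrite ?nnegrE ?mulr_ge0 ?addr_ge0 ?mulr_ge0 //.
  (* This base equals [a * lam + j * eps]: the mean number of hits, plus the shift by [j] in the
     moment bound. *)
  apply: (@le_trans _ _ (n%:R * (p * (m%:R * (a%:R * p) + j%:R)))).
    apply: ler_pM; rewrite ?mulr_ge0 ?addr_ge0 ?mulr_ge0 ?ler_nat //.
    by apply: ler_wpM2l => //; rewrite lerD2r; apply: ler_wpM2l => //; apply: hit_prob_le.
  by rewrite /lam /eps le_eqVlt; apply/orP; left; apply/eqP; ring.
apply: le_trans (void_rate_le an (leq_trans (leq_subr _ _) Nn)) _.
rewrite ler_expR lerN2; apply: ler_wpM2r; first by rewrite exprn_ge0 // subr_ge0.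
apply: ler_wpM2l; first by rewrite mulr_ge0.
apply: ler_wpM2r; first by rewrite invr_ge0.
by rewrite lerBlDr -natrD ler_nat addnC -leq_subLR.
Qed.

Lemma nout_tail_ge0 (pi : R) N K : 0 <= pi <= 1 -> 0 <= nout_tail 'I_m p pi N K.
Proof.
move=> pi01; apply: sumr_ge0 => i _; apply: mulr_ge0 => //; apply: bern_E_ge0 => // U.
by rewrite mulr_ge0 // exprn_ge0 //; case/andP: (hit_prob_01 #|U|) => h1 h2;
   rewrite // -[leRHS](subKr 1) subr_ge0.
Qed.

(** Only the term [j = k.-1] is kept, since it dominates in the critical window. The tangent point
    [lam / n] is the typical probability that an outside node shares an object with a given node. *)
Lemma nout_tail_ge N k : (0 < k)%N -> (N < n)%N -> 0 < lam ->
  'C(N, k.-1)%:R * (lam / n%:R) ^+ k.-1 *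
   ((1 - k.-1%:R) * void_rate 'I_m p p (N - k.-1) +
    k.-1%:R * ((1 - eps) * void_rate 'I_m p p (N - k.-1).+1)) <=
  nout_tail 'I_m p p N k.
Proof.
case: k => // j _ Nn lam_gt0 /=; rewrite /nout_tail big_ord_recr /=.
have /andP[_ p1] := p01; have y0 : 0 <= 1 - p by rewrite subr_ge0.
apply: ler_wpDl.
  apply: sumr_ge0 => i _; apply: mulr_ge0 => //; apply: bern_E_ge0 => // U.
  by rewrite mulr_ge0 // exprn_ge0 ?exprn_ge0 // subr_ge0 exprn_ile1 ?gerBl.
have t0 : 0 < lam / n%:R by rewrite divr_gt0.
rewrite -mulrA; apply: ler_wpM2l => //.
apply: le_trans (hit_pattern_ge 'I_m p01 j (N - j) p01 t0).
apply: ler_wpM2l; first by rewrite exprn_ge0 ?ltW.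
rewrite lerD2l; apply: ler_wpM2l => //; set M := (N - j)%N.
rewrite ler_pdivlMr // /void_rate card_ord.
set u := 1 - p + p * (1 - p) ^+ M; set v := 1 - p + p * (1 - p) ^+ M.+1.
have v0 : 0 <= v by rewrite addr_ge0 ?mulr_ge0 ?exprn_ge0.
have v1 : v <= 1.
  have : p * (1 - p) ^+ M.+1 <= p * 1 by apply: ler_wpM2l => //; rewrite exprn_ile1 ?gerBl.
  by rewrite /v; lra.
have uv : u - v = p ^+ 2 * (1 - p) ^+ M by rewrite /u /v exprS; ring.
have uv0 : 0 <= u - v by rewrite uv mulr_ge0 ?exprn_ge0.
have vu : v <= u by rewrite -subr_ge0.
(* A discrete mean value bound: every term in the factorisation of [u ^+ m - v ^+ m] is at least
   [v ^+ m.-1], hence at least [v ^+ m] because [v <= 1]. *)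
have H : m%:R * (u - v) * v ^+ m <= u ^+ m - v ^+ m.
  rewrite subrXX -mulrA mulrCA; apply: ler_wpM2l => //.
  have -> : m%:R * v ^+ m = \sum_(i < m) v ^+ m by rewrite sumr_const card_ord mulr_natl.
  apply: ler_sum => i _; have im : (m.-1 - i + i)%N = m.-1.
    by rewrite subnK // -ltnS (ltn_predK (ltn_ord i)).
  apply: (@le_trans _ _ (v ^+ (m.-1 - i) * v ^+ i)).
    rewrite -exprD im; apply: ler_wiXn2l => //; exact: leq_pred.
  apply: ler_wpM2r; first exact: exprn_ge0.
  by apply: lerXn2r => //; rewrite nnegrE // (le_trans v0).
apply: le_trans H; rewrite uv /lam mulrAC.
have -> : (1 - eps) * (n%:R * (p ^+ 2 * m%:R) / n%:R) = m%:R * p ^+ 2 * (1 - eps).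
  by field; rewrite gt_eqF.
apply: ler_wpM2r; first exact: exprn_ge0.
rewrite -mulrA; apply: ler_wpM2l => //; apply: ler_wpM2l; first exact: exprn_ge0.
apply: le_trans (bernoulli_ineq M p01); rewrite lerD2l lerN2 ler_wpM2r // ler_nat.
by exact: leq_trans (leq_subr _ _) (ltnW Nn).
Qed.

End Estimates.

Local Open Scope classical_set_scope.

(** * The critical window *)

Section Limits.
Variable R : realType.
Implicit Types (u v w : nat -> R).

Lemma cvg_near_eq u v (l : R) : (\forall n \near \oo, u n = v n) ->
  v n @[n --> \oo] --> l -> u n @[n --> \oo] --> l.
Proof.
by move=> uv; apply: cvg_trans; apply: near_eq_cvg; near=> n; apply/esym; near: n.
Unshelve. all: by end_near. Qed.

Lemma cvg_to_eq u (l l' : R) : l = l' -> u n @[n --> \oo] --> l -> u n @[n --> \oo] --> l'.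
Proof. by move=> ->. Qed.

Lemma near_ge_of_cvgy (b : R) u : u n @[n --> \oo] --> +oo -> \forall n \near \oo, b <= u n.
Proof. by move/cvgryPge; exact. Qed.

Lemma near_le_of_cvg u (l e : R) : l < e -> u n @[n --> \oo] --> l -> \forall n \near \oo, u n <= e.
Proof.
move=> le ul; have /cvgrPdist_le/(_ (e - l)) := ul; rewrite subr_gt0 => /(_ le).
by apply: filterS => n; rewrite distrC => /(le_trans (ler_norm _)); lra.
Qed.

Lemma cvgV_y u : u n @[n --> \oo] --> +oo -> (u n)^-1 @[n --> \oo] --> (0 : R).
Proof.
move=> uy; apply/cvgrPdist_le => e e0; near=> n.
have un : e^-1 <= u n by near: n; apply: near_ge_of_cvgy.
have u0 : 0 < u n by apply: lt_le_trans un; rewrite invr_gt0.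
rewrite sub0r normrN ger0_norm; last by rewrite invr_ge0 ltW.
by rewrite -[e]invrK lef_pV2 ?posrE ?invr_gt0.
Unshelve. all: by end_near. Qed.

Lemma cvg_ln_y u : u n @[n --> \oo] --> +oo -> ln (u n) @[n --> \oo] --> +oo.
Proof.
move=> uy; apply/cvgryPge => A; near=> n.
have un : expR A <= u n by near: n; apply: near_ge_of_cvgy.
by rewrite -[A]expRK ler_ln ?posrE ?expR_gt0 // (lt_le_trans (expR_gt0 A)).
Unshelve. all: by end_near. Qed.

(** One term of the exponential series at [ln (u n)], of degree [K.+1], bounds the quotient by a
    constant over [ln (u n)]. *)
Lemma cvg_ln_pow_div K u : u n @[n --> \oo] --> +oo ->
  ln (u n) ^+ K / u n @[n --> \oo] --> (0 : R).
Proof.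
move=> uy.
apply: (@squeeze_cvgr _ _ _ _ (fun=> 0) (fun n => (K.+1)`!%:R * (ln (u n))^-1)); last first.
- rewrite -[X in _ --> X](mulr0 ((K.+1)`!%:R : R)).
  by apply: cvgM; [exact: cvg_cst|apply: cvgV_y; apply: cvg_ln_y].
- exact: cvg_cst.
near=> n.
have l1 : 1 <= ln (u n) by near: n; apply: near_ge_of_cvgy; apply: cvg_ln_y.
have u1 : 1 <= u n by near: n; apply: near_ge_of_cvgy.
have l0 : 0 < ln (u n) by apply: lt_le_trans l1.
have u0 : 0 < u n by apply: lt_le_trans u1.
apply/andP; split; first by rewrite divr_ge0 ?exprn_ge0 // ltW.
rewrite ler_pdivrMr // mulrAC ler_pdivlMr // -exprSr mulrC.
rewrite -ler_pdivrMr ?ltr0n ?fact_gt0 //.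
have := @expR_ge1Dxn R (ln (u n)) K (ltW l0); rewrite lnK ?posrE //.
by apply: le_trans; rewrite lerDr.
Unshelve. all: by end_near. Qed.

Lemma cvg_natr_y : (n%:R : R) @[n --> \oo] --> +oo.
Proof. by apply/cvgryPge => A; exact: nbhs_infty_ger. Qed.

Lemma cvg_sum_ord K (f : 'I_K -> nat -> R) (l : 'I_K -> R) :
  (forall j, f j n @[n --> \oo] --> l j) ->
  \sum_(j < K) f j n @[n --> \oo] --> \sum_(j < K) l j.
Proof.
elim: K f l => [|K IH] f l H.
  rewrite big_ord0; apply: (@cvg_near_eq _ (fun=> 0)); last exact: cvg_cst.
  by near=> n; rewrite big_ord0.
rewrite big_ord_recr; apply: (@cvg_near_eq _
  (fun n => \sum_(j < K) f (widen_ord (leqnSn K) j) n + f ord_max n)).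
  by near=> n; rewrite big_ord_recr.
by apply: cvgD => //; apply: IH.
Unshelve. all: by end_near. Qed.

Lemma cvgX u (l : R) j : u n @[n --> \oo] --> l -> u n ^+ j @[n --> \oo] --> l ^+ j.
Proof.
move=> ul; elim: j => [|j IH]; first by rewrite expr0; apply: cvg_cst.
rewrite exprS; apply: (@cvg_near_eq _ (fun n => u n * u n ^+ j)).
  by near=> n; rewrite exprS.
exact: cvgM.
Unshelve. all: by end_near. Qed.

Lemma cvg_expR u (l : R) : u n @[n --> \oo] --> l -> expR (u n) @[n --> \oo] --> expR l.
Proof. by move=> ul; apply: continuous_cvg => //; exact: continuous_expR. Qed.

Lemma bin_shift_cvg r j : 'C(n - r, j)%:R / n%:R ^+ j @[n --> \oo] --> (j`!%:R^-1 : R).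
Proof.
have V0 (x : nat) : 1 - x%:R / n%:R @[n --> \oo] --> (1 : R).
  rewrite -[X in _ --> X]subr0 -(mulr0 (x%:R : R)).
  apply: cvgB; first exact: cvg_cst.
  by apply: cvgM; [exact: cvg_cst|exact: cvgV_y cvg_natr_y].
apply: (@squeeze_cvgr _ _ _ _ (fun n => (1 - (r + j)%:R / n%:R) ^+ j * j`!%:R^-1)
  (fun n => j`!%:R^-1)); last 2 first.
- apply: (@cvg_to_eq _ (1 ^+ j * j`!%:R^-1)); first by rewrite expr1n mul1r.
  by apply: cvgM; [apply: cvgX|exact: cvg_cst].
- exact: cvg_cst.
near=> n.
have nr : (r + j < n)%N by near: n; exact: nbhs_infty_gt.
have n0 : 0 < n%:R :> R by rewrite ltr0n; apply: leq_ltn_trans nr.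
have f0 : 0 < j`!%:R :> R by rewrite ltr0n fact_gt0.
have nj0 : 0 < n%:R ^+ j :> R by rewrite exprn_gt0.
apply/andP; split.
  rewrite ler_pdivrMr // mulrAC ler_pdivlMr // -exprMn.
  apply: le_trans (@bin_ge_expn R (n - r) j); rewrite -subnDA natrB 1?ltnW //.
  by rewrite mulrBl mul1r divfK // gt_eqF.
rewrite ler_pdivrMr // mulrC ler_pdivlMr //; apply: le_trans (@bin_le_expn R _ _) _.
by apply: lerXn2r; rewrite ?nnegrE // ler_nat leq_subr.
Unshelve. all: by end_near. Qed.

(** Meant for a limit [E], partial sums [s1], [s2] of its series, and Bonferroni sums [x1], [x2]
    close to them that enclose [y]. *)
Lemma dist_between (E s1 s2 x1 x2 y e : R) : `|E - s1| <= e / 2 -> `|E - s2| <= e / 2 ->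
  `|s1 - x1| <= e / 2 -> `|s2 - x2| <= e / 2 -> x2 <= y -> y <= x1 -> `|E - y| <= e.
Proof.
rewrite !ler_distl => /andP[? ?] /andP[? ?] /andP[? ?] /andP[? ?] ? ?.
by apply/andP; split; lra.
Qed.

Lemma pow_le_fact_expR (x : R) K : 0 <= x -> x ^+ K.+1 <= (K.+1)`!%:R * expR x.
Proof.
move=> x0; rewrite mulrC -ler_pdivrMr ?ltr0n ?fact_gt0 //.
by apply: le_trans (expR_ge1Dxn K x0); rewrite lerDr.
Qed.

Lemma expn_le_fact_expR a : a%:R ^+ a <= a`!%:R * expR a%:R :> R.
Proof.
case: a => [|a]; last exact: pow_le_fact_expR.
by rewrite expr0 fact0 mul1r expR0.
Qed.

Lemma sum_exp_coeff_le (x : R) N : 0 <= x -> \sum_(a < N) x ^+ a / a`!%:R <= expR x.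
Proof.
move=> x0; have H := @is_cvg_series_exp_coeff R x.
apply: le_trans (nondecreasing_cvgn_le _ H N); first by rewrite seriesEord.
apply: nondecreasing_series => a _ _.
by rewrite /exp_coeff /= divr_ge0 // exprn_ge0.
Qed.

(** [n <= a * a] makes [ln a] at least half of [ln n], which suffices while [4 * a <= n]. Beyond
    that, [ln a >= ln n - ln 4] and [a / n <= 1 / 2]; the constant 3 bounds [ln 4]. *)
Lemma big_set_exponent (a n : nat) : (0 < n)%N -> (n <= a * a)%N -> (2 * a <= n)%N ->
  ln n%:R * (a%:R / n%:R) - ln a%:R <= 3 - ln n%:R / 4 :> R.
Proof.
move=> n0 na an.
have n0' : 0 < n%:R :> R by rewrite ltr0n.
have a0 : (0 < a)%N by case: (a) na n0 => //; rewrite muln0 leqn0 => /eqP->.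
have a0' : 0 < a%:R :> R by rewrite ltr0n.
have L0 : 0 <= ln n%:R :> R by rewrite ln_ge0 // ler1n.
have la : ln n%:R <= 2 * ln a%:R :> R.
  rewrite mulrC mulr_natr mulr2n -lnM ?posrE // ler_ln ?posrE ?mulr_gt0 //.
  by rewrite -natrM ler_nat.
case: (leqP (4 * a) n) => h.
  have r4 : a%:R / n%:R <= 4^-1 :> R.
    rewrite ler_pdivrMr // mulrC ler_pdivlMr // mulrC -natrM ler_nat //.
  have := ler_wpM2l L0 r4; lra.
have r2 : a%:R / n%:R <= 2^-1 :> R.
  rewrite ler_pdivrMr // mulrC ler_pdivlMr // mulrC -natrM ler_nat //.
have l4 : ln 4 <= 3 :> R.
  have -> : 4 = 1 + 3 :> R by ring.
  by apply: le_ln1Dx; lra.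
have ln4a : ln n%:R <= ln 4 + ln a%:R :> R.
  rewrite -lnM ?posrE // ler_ln ?posrE ?mulr_gt0 // -natrM ler_nat; exact: ltnW.
by have := ler_wpM2l L0 r2; lra.
Qed.

End Limits.

Section Critical.
(** Here [k] is the order of connectivity minus one: it is the coefficient of the iterated
    logarithm, and the conclusions concern [k.+1]. *)
Variables (R : realType) (k : nat) (P : nat -> nat) (p al : nat -> R) (c : R).
Variables L lam eps : nat -> R.
Hypothesis L_def : forall n, L n = ln n%:R.
Hypothesis lam_def : forall n, lam n = n%:R * (p n ^+ 2 * (P n)%:R).
Hypothesis eps_def : forall n, eps n = n%:R * p n.
Hypothesis p01 : forall n, 0 <= p n <= 1.
Hypothesis lamE : \forall n \near \oo, lam n = L n + k%:R * ln (L n) + al n.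
Hypothesis al_c : al n @[n --> \oo] --> c.
Hypothesis P_big : \forall n \near \oo, n%:R * L n ^+ 5 <= (P n)%:R.

(** * Asymptotics of [lam] and [eps] *)

Lemma L_y : L n @[n --> \oo] --> +oo.
Proof.
have -> : L = (fun n => ln n%:R) by apply/funext.
by apply: cvg_ln_y; exact: cvg_natr_y.
Qed.

Lemma lam_L : lam n / L n @[n --> \oo] --> (1 : R).
Proof.
apply: (@cvg_near_eq _ _ (fun n => 1 + k%:R * (ln (L n) ^+ 1 / L n) + al n * (L n)^-1)).
  near=> n; have L1 : 1 <= L n by near: n; apply: near_ge_of_cvgy L_y.
  have -> : lam n = L n + k%:R * ln (L n) + al n by near: n.
  by field; rewrite gt_eqF // (lt_le_trans _ L1).
apply: (@cvg_to_eq _ _ (1 + k%:R * 0 + c * 0)); first by rewrite !mulr0 !addr0.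
apply: cvgD; [apply: cvgD; [exact: cvg_cst|]|].
  by apply: cvgM; [exact: cvg_cst|apply: cvg_ln_pow_div L_y].
by apply: cvgM => //; apply: cvgV_y L_y.
Unshelve. all: by end_near. Qed.

Lemma lam_le2L : \forall n \near \oo, L n / 2 <= lam n <= 2 * L n.
Proof.
near=> n; have L1 : 1 <= L n by near: n; apply: near_ge_of_cvgy L_y.
have L0 : 0 < L n by apply: lt_le_trans L1.
have : `|1 - lam n / L n| <= 2^-1.
  by near: n; move/cvgrPdist_le: lam_L; apply; rewrite invr_gt0.
rewrite ler_distl => /andP[h1 h2].
have e : lam n / L n * L n = lam n by rewrite divfK // gt_eqF.
have : 2^-1 * L n <= lam n / L n * L n by apply: ler_wpM2r; [exact: ltW|lra].
have : lam n / L n * L n <= (3 / 2) * L n by apply: ler_wpM2r; [exact: ltW|lra].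
by rewrite e; lra.
Unshelve. all: by end_near. Qed.

Lemma lam_y : lam n @[n --> \oo] --> +oo.
Proof.
apply/cvgryPge => A; near=> n.
have /andP[h _] : L n / 2 <= lam n <= 2 * L n by near: n; exact: lam_le2L.
apply: le_trans h; rewrite ler_pdivlMr //; near: n; exact: near_ge_of_cvgy L_y.
Unshelve. all: by end_near. Qed.

Lemma lam_pow_n K : lam n ^+ K / n%:R @[n --> \oo] --> (0 : R).
Proof.
apply: (@cvg_near_eq _ _ (fun n => (lam n / L n) ^+ K * (L n ^+ K / n%:R))).
  near=> n; have L1 : 1 <= L n by near: n; apply: near_ge_of_cvgy L_y.
  by rewrite mulrA -exprMn divfK // gt_eqF // (lt_le_trans _ L1).
apply: (@cvg_to_eq _ _ (1 ^+ K * 0)); first by rewrite mulr0.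
apply: cvgM; first exact: cvgX lam_L.
have -> : L = (fun n => ln n%:R) by apply/funext.
by apply: cvg_ln_pow_div; exact: cvg_natr_y.
Unshelve. all: by end_near. Qed.

Lemma lam_n : lam n / n%:R @[n --> \oo] --> (0 : R).
Proof.
apply: (@cvg_near_eq _ _ (fun n => lam n ^+ 1 / n%:R)); last exact: lam_pow_n.
by near=> n; rewrite expr1.
Unshelve. all: by end_near. Qed.

Lemma eps_ge0 n : 0 <= eps n.
Proof. by have /andP[p0 _] := p01 n; rewrite eps_def mulr_ge0. Qed.

(** Since [eps ^+ 2 * P = n * lam <= 2 * n * L], the bound [P >= n * L ^+ 5] gives
    [eps ^+ 2 * L ^+ 4 <= 2]. The exponent 5 thus makes [eps] of order [L ^ -2], which is what
    [lam * eps -> 0] draws on. *)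
Lemma epsL_le : \forall n \near \oo, eps n * L n <= 2 * (L n)^-1.
Proof.
near=> n; have L1 : 1 <= L n by near: n; apply: near_ge_of_cvgy L_y.
have L0 : 0 < L n by apply: lt_le_trans L1.
have /andP[_ h] : L n / 2 <= lam n <= 2 * L n by near: n; exact: lam_le2L.
have Pn : n%:R * L n ^+ 5 <= (P n)%:R by near: n.
have n0 : 0 < n%:R :> R by rewrite ltr0n; near: n; exact: nbhs_infty_gt.
rewrite ler_pdivlMr //.
suff : (eps n * L n * L n) ^+ 2 <= 2 ^+ 2.
  have A0 : 0 <= eps n * L n * L n by rewrite !mulr_ge0 ?eps_ge0 ?(ltW L0).
  by rewrite ler_sqr ?nnegrE.
have eP : eps n ^+ 2 * (P n)%:R = n%:R * lam n by rewrite eps_def lam_def; ring.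
have H : eps n ^+ 2 * (n%:R * L n ^+ 5) <= n%:R * (2 * L n).
  apply: (@le_trans _ _ (eps n ^+ 2 * (P n)%:R)); first by rewrite ler_wpM2l ?sqr_ge0.
  by rewrite eP ler_wpM2l // ltW.
have : (n%:R * L n) * (eps n * L n * L n) ^+ 2 <= (n%:R * L n) * 2.
  by apply: le_trans (le_trans H _); rewrite le_eqVlt; apply/orP; left; apply/eqP; ring.
rewrite ler_pM2l ?mulr_gt0 // => /le_trans; apply.
by rewrite expr2; lra.
Unshelve. all: by end_near. Qed.

Lemma epsL_0 : eps n * L n @[n --> \oo] --> (0 : R).
Proof.
apply: (@squeeze_cvgr _ _ _ _ (fun=> 0) (fun n => 2 * (L n)^-1)).
- near=> n; have L1 : 1 <= L n by near: n; apply: near_ge_of_cvgy L_y.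
  rewrite mulr_ge0 ?eps_ge0 ?(le_trans _ L1) //=; near: n; exact: epsL_le.
- exact: cvg_cst.
- apply: (@cvg_to_eq _ _ (2 * 0)); first by rewrite mulr0.
  by apply: cvgM; [exact: cvg_cst|exact: cvgV_y L_y].
Unshelve. all: by end_near. Qed.

Lemma lam_eps : lam n * eps n @[n --> \oo] --> (0 : R).
Proof.
apply: (@cvg_near_eq _ _ (fun n => (lam n / L n) * (eps n * L n))).
  near=> n; have L1 : 1 <= L n by near: n; apply: near_ge_of_cvgy L_y.
  by field; rewrite gt_eqF // (lt_le_trans _ L1).
by apply: (@cvg_to_eq _ _ (1 * 0)); [rewrite mulr0|apply: cvgM lam_L epsL_0].
Unshelve. all: by end_near. Qed.

Lemma eps_0 : eps n @[n --> \oo] --> (0 : R).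
Proof.
apply: (@cvg_near_eq _ _ (fun n => (eps n * L n) * (L n)^-1)).
  near=> n; have L1 : 1 <= L n by near: n; apply: near_ge_of_cvgy L_y.
  by rewrite mulfK // gt_eqF // (lt_le_trans _ L1).
by apply: (@cvg_to_eq _ _ (0 * 0)); [rewrite mulr0|apply: cvgM epsL_0 (cvgV_y L_y)].
Unshelve. all: by end_near. Qed.

Lemma n_explam : n%:R * expR (- lam n) * L n ^+ k @[n --> \oo] --> expR (- c).
Proof.
apply: (@cvg_near_eq _ _ (fun n => expR (- al n))); last first.
  by apply: cvg_expR; apply: cvgN.
near=> n; have L1 : 1 <= L n by near: n; apply: near_ge_of_cvgy L_y.
have n0 : 0 < n%:R :> R by rewrite ltr0n; near: n; exact: nbhs_infty_gt.
have -> : lam n = L n + k%:R * ln (L n) + al n by near: n.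
have L0 : 0 < L n by apply: lt_le_trans L1.
have -> : L n ^+ k = expR (k%:R * ln (L n)) by rewrite -expR_natl lnK.
have -> : n%:R = expR (L n) by rewrite L_def lnK.
rewrite -!expRD.
by congr expR; ring.
Unshelve. all: by end_near. Qed.

(** As [lam] and [L] are asymptotically equal, this is [n_explam] divided by [L ^+ (k - j)]. With
    [0 ^+ 0 = 1], one formula says that [j = k] survives and lower powers vanish. *)
Lemma n_lam_exp j : (j <= k)%N ->
  n%:R * (lam n ^+ j * expR (- lam n)) @[n --> \oo] --> 0 ^+ (k - j) * expR (- c).
Proof.
move=> jk; apply: (@cvg_near_eq _ _ (fun n => (lam n / L n) ^+ j * ((L n)^-1 ^+ (k - j) *
   (n%:R * expR (- lam n) * L n ^+ k)))).
  near=> n; have L1 : 1 <= L n by near: n; apply: near_ge_of_cvgy L_y.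
  have L0 : L n != 0 by rewrite gt_eqF // (lt_le_trans _ L1).
  rewrite -[in L n ^+ k](subnK jk) exprD exprMn.
  have E i : (L n)^-1 ^+ i * L n ^+ i = 1 by rewrite -exprMn mulVf // expr1n.
  transitivity (n%:R * (lam n ^+ j * expR (- lam n)) * ((L n)^-1 ^+ j * L n ^+ j) *
    ((L n)^-1 ^+ (k - j) * L n ^+ (k - j))); first by rewrite !E !mulr1.
  ring.
apply: (@cvg_to_eq _ _ (1 ^+ j * (0 ^+ (k - j) * expR (- c)))).
  by rewrite expr1n mul1r.
apply: cvgM; first exact: cvgX lam_L.
by apply: cvgM n_explam; apply: cvgX; apply: cvgV_y L_y.
Unshelve. all: by end_near. Qed.

(** The gap between [lam] and the exponent that [nout_tail_le] gives for one node and [N = n - r].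
    Its main part is [lam * eps * (2 - eps)], so [D_0] rests on [lam_eps]. *)
Let D r j n : R := lam n - lam n * (((n - r)%N%:R - j%:R) / n%:R) * (1 - eps n) ^+ 2.

Lemma D_0 r j : D r j n @[n --> \oo] --> (0 : R).
Proof.
apply: (@cvg_near_eq _ _ (fun n => lam n * eps n * (2 - eps n) +
   (r + j)%:R * (lam n / n%:R) * (1 - eps n) ^+ 2)).
  near=> n; have n0 : 0 < n%:R :> R by rewrite ltr0n; near: n; exact: nbhs_infty_gt.
  have rn : (r <= n)%N by near: n; exact: nbhs_infty_ge.
  by rewrite /D natrB // natrD; field; rewrite gt_eqF.
apply: (@cvg_to_eq _ _ (0 * (2 - 0) + (r + j)%:R * 0 * (1 - 0) ^+ 2)).
  by rewrite mulr0 !mul0r addr0.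
apply: cvgD.
  by apply: cvgM lam_eps _; apply: cvgB eps_0; exact: cvg_cst.
apply: cvgM; first by apply: cvgM lam_n; exact: cvg_cst.
by apply: cvgX; apply: cvgB eps_0; exact: cvg_cst.
Unshelve. all: by end_near. Qed.

Lemma shift_ratio (a : R) j : (a * lam n + j%:R * eps n) / lam n @[n --> \oo] --> a.
Proof.
apply: (@cvg_near_eq _ _ (fun n => a + j%:R * (eps n * (lam n)^-1))).
  near=> n; have l1 : 1 <= lam n by near: n; apply: near_ge_of_cvgy lam_y.
  by field; rewrite gt_eqF // (lt_le_trans _ l1).
apply: (@cvg_to_eq _ _ (a + j%:R * (0 * 0))); first by rewrite !mulr0 addr0.
apply: cvgD; first exact: cvg_cst.
by apply: cvgM; [exact: cvg_cst|apply: cvgM eps_0 (cvgV_y lam_y)].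
Unshelve. all: by end_near. Qed.

Lemma void_cvg s (M : nat -> nat) : (\forall n \near \oo, (n - s <= M n <= n)%N) ->
  n%:R * (lam n ^+ k * void_rate 'I_(P n) (p n) (p n) (M n)) @[n --> \oo] --> expR (- c).
Proof.
move=> Ms; have nl := n_lam_exp (leqnn k); rewrite subnn expr0 mul1r in nl.
apply: (@squeeze_cvgr _ _ _ _
  (fun n => n%:R * (lam n ^+ k * expR (- lam n)) * expR (- (lam n * eps n * (1 - eps n)^-1)))
  (fun n => n%:R * (lam n ^+ k * expR (- lam n)) * expR (D s 0 n))).
- near=> n.
  have n0 : (0 < n)%N by near: n; exact: nbhs_infty_gt.
  have n0' : 0 < n%:R :> R by rewrite ltr0n.
  have e1 : eps n <= 2^-1.
    by near: n; apply: near_le_of_cvg eps_0; rewrite invr_gt0.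
  have l1 : 1 <= lam n by near: n; apply: near_ge_of_cvgy lam_y.
  have l0 : 0 <= lam n by apply: le_trans l1.
  have /andP[M1 M2] : (n - s <= M n <= n)%N by near: n.
  have np1 : n%:R * p n <= 1 by rewrite -eps_def; lra.
  have e1' : n%:R * p n < 1 by rewrite -eps_def; lra.
  rewrite -!mulrA; apply/andP; split; apply: ler_wpM2l (ltW n0') _ _ _;
    apply: ler_wpM2l (exprn_ge0 k l0) _ _ _; rewrite -expRD.
    apply: le_trans (@void_rate_ge R n (P n) (p n) (p01 n) (M n) e1' M2).
    rewrite ler_expR -lam_def -eps_def le_eqVlt; apply/orP; left; apply/eqP.
    by field; rewrite gt_eqF // subr_gt0 eps_def.
  have := @void_rate_le R n (P n) (p n) n0 (p01 n) np1 1 (M n) n0 M2.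
  have -> : 1 - (1 - p n) ^+ 1 = p n by rewrite expr1; ring.
  move/le_trans; apply; rewrite ler_expR /D -lam_def -eps_def subr0.
  have : lam n * ((n - s)%N%:R / n%:R) * (1 - eps n) ^+ 2 <=
         lam n * ((M n)%:R / n%:R) * (1 - eps n) ^+ 2.
    apply: ler_wpM2r; first exact: sqr_ge0.
    by apply: ler_wpM2l => //; apply: ler_wpM2r; rewrite ?invr_ge0 ?ler_nat.
  by rewrite mul1r; lra.
- apply: (@cvg_to_eq _ _ (expR (- c) * expR (- (0 * (1 - 0)^-1)))).
    by rewrite mul0r oppr0 expR0 mulr1.
  apply: cvgM nl _; apply: cvg_expR; apply: cvgN; apply: cvgM lam_eps _.
  apply: cvgV; first by rewrite subr0 oner_neq0.
  by apply: cvgB eps_0; exact: cvg_cst.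
- apply: (@cvg_to_eq _ _ (expR (- c) * expR 0)); first by rewrite expR0 mulr1.
  by apply: cvgM nl _; apply: cvg_expR; exact: D_0.
Unshelve. all: by end_near. Qed.

(** * Poisson limit for the number of low-degree nodes *)

Let mu : R := expR (- c) / k`!%:R.

Lemma near_small : \forall n \near \oo,
  [/\ (0 < n)%N, eps n <= 2^-1, 1 <= lam n & n%:R * p n <= 1].
Proof.
near=> n.
have e1 : eps n <= 2^-1.
  by near: n; apply: near_le_of_cvg eps_0; rewrite invr_gt0.
split=> //; [near: n; exact: nbhs_infty_gt|near: n; exact: near_ge_of_cvgy lam_y|].
by rewrite -eps_def; lra.
Unshelve. all: by end_near. Qed.

(** Exactly [k] neighbours is the decisive case. Above, [n_lam_exp] kills the terms [j < k]; below,
    the tangent weights [1 - k] and [k * (1 - eps)] add up to 1 in the limit. *)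
Lemma node_tail_cvg r : (0 < r)%N ->
  n%:R * nout_tail 'I_(P n) (p n) (p n) (n - r) k.+1 @[n --> \oo] --> mu.
Proof.
move=> r0.
apply: (@squeeze_cvgr _ _ _ _
  (fun n => ('C(n - r, k)%:R / n%:R ^+ k) *
     ((1 - k%:R) * (n%:R * (lam n ^+ k * void_rate 'I_(P n) (p n) (p n) (n - r - k))) +
      k%:R * ((1 - eps n) * (n%:R * (lam n ^+ k *
         void_rate 'I_(P n) (p n) (p n) (n - r - k).+1)))))
  (fun n => \sum_(j < k.+1) ((n%:R * (lam n ^+ j * expR (- lam n))) *
      ((1 * lam n + j%:R * eps n) / lam n) ^+ j / j`!%:R * expR (D r j n)))).
- near=> n.
  have [n0 e1 l1 np1] : [/\ (0 < n)%N, eps n <= 2^-1, 1 <= lam n & n%:R * p n <= 1].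
    by near: n; exact: near_small.
  have n0' : 0 < n%:R :> R by rewrite ltr0n.
  have l0 : 0 < lam n by apply: lt_le_trans l1.
  apply/andP; split.
    have Nn : (n - r < n)%N by rewrite ltn_subrL r0.
    have l0' : 0 < n%:R * (p n ^+ 2 * (P n)%:R) by rewrite -lam_def.
    have := ler_wpM2l (ltW n0') (@nout_tail_ge R n (P n) (p n) n0 (p01 n) (n - r) k.+1
      isT Nn l0').
    apply: le_trans; rewrite /= -lam_def -eps_def le_eqVlt; apply/orP; left; apply/eqP.
    rewrite [(lam n / _) ^+ _]exprMn exprVn; move: (void_rate _ _ _ _) (void_rate _ _ _ _).
    by move=> x y; ring.
  have := ler_wpM2l (ltW n0') (@nout_tail_le R n (P n) (p n) n0 (p01 n) np1 1 (n - r) k.+1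
      n0 (leq_subr _ _)).
  have -> : 1 - (1 - p n) ^+ 1 = p n by rewrite expr1; ring.
  move/le_trans; apply; rewrite mulr_sumr; apply: ler_sum => j _.
  rewrite -lam_def -eps_def /D expRD expRN mul1r le_eqVlt; apply/orP; left; apply/eqP.
  rewrite [(_ / lam n) ^+ _]exprMn exprVn.
  have lj : lam n ^+ j != 0 by rewrite expf_neq0 // gt_eqF.
  have el : expR (lam n) != 0 by rewrite gt_eqF ?expR_gt0.
  have fj : j`!%:R != 0 :> R by rewrite pnatr_eq0 -lt0n fact_gt0.
  rewrite !expRN; set E := expR (_ * _); have En : E != 0 by rewrite gt_eqF ?expR_gt0.
  move: lj el fj En; move: (lam n ^+ j) (expR (lam n)) (j`!%:R : R) E (_ ^+ j).
  by move=> x1 x2 x3 x4 x5 h1 h2 h3 h4; field; rewrite h1 h2 h3 h4.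
- have Mk x : (x <= 1)%N -> \forall n \near \oo, (n - (r + k) <= n - r - k + x <= n)%N.
    move=> x1; near=> n; have : (r < n)%N by near: n; exact: nbhs_infty_gt.
    by rewrite -subnDA; lia.
  apply: (@cvg_to_eq _ _ (k`!%:R^-1 * ((1 - k%:R) * expR (- c) + k%:R * ((1 - 0) * expR (- c))))).
    by rewrite /mu subr0; ring.
  apply: cvgM; first exact: bin_shift_cvg.
  apply: cvgD; (apply: cvgM; first exact: cvg_cst).
    apply: (@void_cvg (r + k)); have := Mk 0%N isT; apply: filterS => n.
    by rewrite addn0.
  apply: cvgM; first by apply: cvgB eps_0; exact: cvg_cst.
  apply: (@void_cvg (r + k) (fun n => (n - r - k).+1)); have := Mk 1%N isT; apply: filterS => n.
  by rewrite addn1.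
- apply: (@cvg_to_eq _ _ (\sum_(j < k.+1) (0 ^+ (k - j) * expR (- c) * 1 ^+ j / j`!%:R * expR 0))).
    rewrite big_ord_recr /= subnn expr0 expr1n expR0 !mulr1 mul1r big1 ?add0r // => j _.
    by rewrite expr0n subn_eq0 leqNgt ltn_ord !mul0r.
  apply: cvg_sum_ord => j; apply: cvgM; last by apply: cvg_expR; exact: D_0.
  apply: cvgM; last exact: cvg_cst.
  by apply: cvgM; [apply: n_lam_exp; rewrite -ltnS|apply: cvgX; exact: shift_ratio].
Unshelve. all: by end_near. Qed.


(** The inner-edge error in the [r]-th factorial moment: [n ^ r] times the tail is at most powers of
    [lam] times a bounded quantity, and the division by [n] beats every power of [lam]. *)
Lemma set_tail_cvg r K : (lam n / n%:R) * (n%:R ^+ r *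
    nout_tail 'I_(P n) (p n) (1 - (1 - p n) ^+ r) (n - r) K) @[n --> \oo] --> (0 : R).
Proof.
apply: (@squeeze_cvgr _ _ _ _ (fun=> 0)
  (fun n => \sum_(j < K) ((lam n ^+ j.+1 / n%:R) *
      ((r%:R * lam n + j%:R * eps n) / lam n) ^+ j / j`!%:R *
      ((n%:R * (lam n ^+ 0 * expR (- lam n))) * expR (D r j n)) ^+ r))).
- near=> n.
  have [n0 e1 l1 np1] : [/\ (0 < n)%N, eps n <= 2^-1, 1 <= lam n & n%:R * p n <= 1].
    by near: n; exact: near_small.
  have rn : (r <= n)%N by near: n; exact: nbhs_infty_ge.
  have n0' : 0 < n%:R :> R by rewrite ltr0n.
  have l0 : 0 < lam n by apply: lt_le_trans l1.
  have w0 : 0 <= lam n / n%:R * n%:R ^+ r by rewrite mulr_ge0 ?exprn_ge0 // divr_ge0 // ltW.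
  rewrite [X in _ <= X <= _]mulrA; apply/andP; split.
    by apply: mulr_ge0 => //; apply: (nout_tail_ge0 _ (p01 n)); exact: hit_prob_01.
  have := ler_wpM2l w0 (@nout_tail_le R n (P n) (p n) n0 (p01 n) np1 r (n - r) K
      rn (leq_subr _ _)).
  move/le_trans; apply; rewrite mulr_sumr; apply: ler_sum => j _.
  rewrite -lam_def -eps_def /D.
  set Y := lam n * (((n - r)%N%:R - j%:R) / n%:R) * (1 - eps n) ^+ 2.
  have -> : n%:R * (lam n ^+ 0 * expR (- lam n)) * expR (lam n - Y) = n%:R * expR (- Y).
    by rewrite expr0 mul1r -mulrA -expRD; congr (_ * expR _); ring.
  have -> : - (r%:R * lam n * (((n - r)%N%:R - j%:R) / n%:R) * (1 - eps n) ^+ 2) = r%:R * - Y.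
    by rewrite /Y; ring.
  rewrite [(n%:R * _) ^+ r]exprMn expR_natl exprS [(_ / lam n) ^+ j]exprMn exprVn.
  rewrite le_eqVlt; apply/orP; left; apply/eqP.
  have lj : lam n ^+ j != 0 by rewrite expf_neq0 // gt_eqF.
  have fj : j`!%:R != 0 :> R by rewrite pnatr_eq0 -lt0n fact_gt0.
  have nn : n%:R != 0 :> R by rewrite gt_eqF.
  move: lj fj nn; move: (lam n ^+ j) (j`!%:R : R) (expR _) (_ ^+ j) (n%:R ^+ r).
  move: (n%:R : R) (lam n).
  by move=> y z x1 x2 x3 x4 x5 h1 h2 h3; field; rewrite h1 h2 h3.
- exact: cvg_cst.
- apply: (@cvg_to_eq _ _ (\sum_(j < K) (0 * r%:R ^+ j / j`!%:R *
     (0 ^+ (k - 0) * expR (- c) * expR 0) ^+ r))).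
    by rewrite big1 // => j _; rewrite !mul0r.
  apply: cvg_sum_ord => j; apply: cvgM.
    apply: cvgM; last exact: cvg_cst.
    by apply: cvgM; [exact: lam_pow_n|apply: cvgX; exact: shift_ratio].
  apply: cvgX; apply: cvgM; first by apply: n_lam_exp.
  by apply: cvg_expR; exact: D_0.
Unshelve. all: by end_near. Qed.

Lemma sum_card_cst (T : finType) r (x : R) :
  \sum_(A : {set T} | #|A| == r) x = 'C(#|T|, r)%:R * x.
Proof. by rewrite -card_draws mulr_natl -sumr_const; apply: eq_bigl => A; rewrite inE. Qed.

Lemma bad_moment_cvg r :
  bad_moment 'I_n 'I_(P n) (p n) k.+1 r @[n --> \oo] --> mu ^+ r / r`!%:R.
Proof.
pose q n := nout_tail 'I_(P n) (p n) (p n) (n - r) k.+1.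
have nq : (n%:R * q n) ^+ r @[n --> \oo] --> mu ^+ r.
  case: r @q => [|r] q; first by rewrite expr0; exact: cvg_cst.
  by apply: cvgX; exact: node_tail_cvg.
pose T n := nout_tail 'I_(P n) (p n) (1 - (1 - p n) ^+ r) (n - r) (r * k + 1).
have B0 := @bin_shift_cvg R 0 r.
have B : 'C(n, r)%:R / n%:R ^+ r @[n --> \oo] --> (r`!%:R^-1 : R).
  by apply: cvg_near_eq B0; near=> n; rewrite subn0.
apply: (@squeeze_cvgr _ _ _ _
  (fun n => 'C(n, r)%:R / n%:R ^+ r * ((1 - (r ^ 2)%:R * (lam n / n%:R)) * (n%:R * q n) ^+ r))
  (fun n => 'C(n, r)%:R / n%:R ^+ r * ((n%:R * q n) ^+ r + (r ^ 2)%:R *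
     (lam n / n%:R * (n%:R ^+ r * T n))))).
- near=> n.
  have n0 : (0 < n)%N by near: n; exact: nbhs_infty_gt.
  have nn : n%:R != 0 :> R by rewrite pnatr_eq0 -lt0n.
  have nr : n%:R ^+ r != 0 :> R by rewrite expf_neq0.
  have Pl : (P n)%:R * p n ^+ 2 = lam n / n%:R by rewrite lam_def; field.
  have cA (A : {set 'I_n}) : #|A| = r -> #|~: A| = (n - r)%N.
    by move=> Ar; rewrite cardsCs finset.setCK card_ord Ar.
  apply/andP; split.
    apply: (@le_trans _ _ (\sum_(A : {set 'I_n} | #|A| == r)
        ((1 - (r ^ 2)%:R * (P n)%:R * p n ^+ 2) * q n ^+ r))).
      rewrite sum_card_cst card_ord -[_ * (P n)%:R * _]mulrA Pl exprMn le_eqVlt.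
      by apply/orP; left; apply/eqP; field; rewrite nr nn.
    apply: ler_sum => A /eqP Ar; have := @all_bad_ge R 'I_n 'I_(P n) (p n) (p01 n) k.+1 A.
    by rewrite cA // Ar card_ord.
  apply: (@le_trans _ _ (\sum_(A : {set 'I_n} | #|A| == r)
      (q n ^+ r + (r ^ 2)%:R * (P n)%:R * p n ^+ 2 * T n))).
    apply: ler_sum => A /eqP Ar; have := @all_bad_le R 'I_n 'I_(P n) (p n) (p01 n) k.+1 A isT.
    by rewrite cA // Ar card_ord.
  rewrite sum_card_cst card_ord -[_ * (P n)%:R * _]mulrA Pl exprMn le_eqVlt.
  by apply/orP; left; apply/eqP; field; rewrite nr nn.
- apply: (@cvg_to_eq _ _ (r`!%:R^-1 * ((1 - (r ^ 2)%:R * 0) * mu ^+ r))).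
    by rewrite mulr0 subr0 mul1r mulrC.
  apply: cvgM B _; apply: cvgM nq; apply: cvgB; first exact: cvg_cst.
  by apply: cvgM lam_n; exact: cvg_cst.
- apply: (@cvg_to_eq _ _ (r`!%:R^-1 * (mu ^+ r + (r ^ 2)%:R * 0))).
    by rewrite mulr0 addr0 mulrC.
  apply: cvgM B _; apply: cvgD nq _; apply: cvgM; first exact: cvg_cst.
  exact: set_tail_cvg.
Unshelve. all: by end_near. Qed.

Lemma mindeg_cvg : mindeg_prob 'I_n 'I_(P n) (p n) k.+1 @[n --> \oo] --> expR (- mu).
Proof.
have [S SE] : exists S : nat -> R, forall N, S N = \sum_(r < N) (-1) ^+ r * (mu ^+ r / r`!%:R).
  by exists (fun N => \sum_(r < N) (-1) ^+ r * (mu ^+ r / r`!%:R)).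
have Scvg : S N @[N --> \oo] --> expR (- mu).
  have H := @is_cvg_series_exp_coeff R (- mu).
  apply: (@cvg_near_eq _ _ (series (exp_coeff (- mu)))); last exact: H.
  near=> N; rewrite seriesEord SE; apply: eq_bigr => r _.
  by rewrite /exp_coeff /= [(- mu) ^+ _]exprNn mulrA.
apply/cvgrPdist_le => e e0.
have e2 : 0 < e / 2 by rewrite divr_gt0.
(* The truncation level is fixed before [n] grows, so only finitely many moments have to be close to
   their limits. *)
have /cvgrPdist_le/(_ _ e2) [N0 _ HN0] := Scvg.
have Bon N : \sum_(r < N) (-1) ^+ r * bad_moment 'I_n 'I_(P n) (p n) k.+1 r @[n --> \oo] --> S N.
  by rewrite SE; apply: cvg_sum_ord => r; apply: cvgM; [exact: cvg_cst|exact: bad_moment_cvg].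
have N0e : (N0 <= N0.*2.+1)%N by rewrite -addnn; lia.
have N0o : (N0 <= N0.*2.+2)%N by rewrite -addnn; lia.
have He := HN0 _ N0e; have Ho := HN0 _ N0o; rewrite /= in He Ho.
near=> n.
have b1 : `|S N0.*2.+1 - \sum_(r < N0.*2.+1)
    (-1) ^+ r * bad_moment 'I_n 'I_(P n) (p n) k.+1 r| <= e / 2.
  by near: n; have /cvgrPdist_le/(_ _ e2) := Bon N0.*2.+1; exact.
have b2 : `|S N0.*2.+2 - \sum_(r < N0.*2.+2)
    (-1) ^+ r * bad_moment 'I_n 'I_(P n) (p n) k.+1 r| <= e / 2.
  by near: n; have /cvgrPdist_le/(_ _ e2) := Bon N0.*2.+2; exact.
have m1 := @mindeg_le R 'I_n 'I_(P n) (p n) k.+1 (p01 n) N0.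
have m2 := @mindeg_ge R 'I_n 'I_(P n) (p n) k.+1 (p01 n) N0.
exact: dist_between He Ho b1 b2 m2 m1.
Unshelve. all: by end_near. Qed.


(** * Union bound over sets of nodes *)

Lemma near_lam_L : \forall n \near \oo, n%:R * expR (- lam n) <= expR (1 - c).
Proof.
have H := n_lam_exp (leq0n k); rewrite subn0 in H.
(* The extra 1 in the exponent leaves a strict gap above the limit, which is at most
   [expR (- c)]. *)
have lt : 0 ^+ k * expR (- c) < expR (1 - c).
  apply: (@le_lt_trans _ _ (expR (- c))).
    by rewrite ler_piMl ?expR_ge0 // exprn_ile1.
  by rewrite ltr_expR ltrDr.
have := near_le_of_cvg lt H; apply: filterS => n; by rewrite expr0 mul1r.
Qed.

(** Uniform in [a], as the sum over all sizes requires. The summand 1 in the exponent pays for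
    [2 * lam * eps] and [j * lam / n], each eventually at most one half; the factor 2 on [lam]
    absorbs [j * eps]. *)
Lemma set_tail_le : \forall n \near \oo, forall a, (0 < a)%N -> (a <= n)%N ->
  nout_tail 'I_(P n) (p n) (1 - (1 - p n) ^+ a) (n - a) k.+1 <=
  k.+1%:R * (a%:R * (2 * lam n)) ^+ k * expR (a%:R * (1 - lam n * (1 - a%:R / n%:R))).
Proof.
near=> n => a a0 an.
have [n0 e1 l1 np1] : [/\ (0 < n)%N, eps n <= 2^-1, 1 <= lam n & n%:R * p n <= 1].
  by near: n; exact: near_small.
have n0' : 0 < n%:R :> R by rewrite ltr0n.
have l0 : 0 < lam n by apply: lt_le_trans l1.
have lk : k%:R <= lam n by near: n; exact: near_ge_of_cvgy lam_y.
have le4 : lam n * eps n <= 4^-1.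
  by near: n; apply: near_le_of_cvg lam_eps; rewrite invr_gt0.
have lnk : k%:R * (lam n / n%:R) <= 2^-1.
  near: n; apply: (@near_le_of_cvg R (fun n => k%:R * (lam n / n%:R)) (k%:R * 0)).
    by rewrite mulr0 invr_gt0.
  by apply: cvgM lam_n; exact: cvg_cst.
have a1 : 1 <= a%:R :> R by rewrite ler1n.
apply: le_trans (@nout_tail_le R n (P n) (p n) n0 (p01 n) np1 a (n - a) k.+1 an (leq_subr _ _)) _.
rewrite -lam_def -eps_def.
have -> : k.+1%:R * (a%:R * (2 * lam n)) ^+ k * expR (a%:R * (1 - lam n * (1 - a%:R / n%:R))) =
  \sum_(j < k.+1) (a%:R * (2 * lam n)) ^+ k * expR (a%:R * (1 - lam n * (1 - a%:R / n%:R))).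
  by rewrite sumr_const card_ord -mulrA mulr_natl.
apply: ler_sum => j _; have jk : (j <= k)%N by rewrite -ltnS.
have jk' : j%:R <= k%:R :> R by rewrite ler_nat.
have e0 := eps_ge0 n.
have u0 : 0 <= a%:R * lam n + j%:R * eps n by rewrite addr_ge0 // mulr_ge0 // ltW.
apply: ler_pM.
- by rewrite divr_ge0 // exprn_ge0.
- exact: expR_ge0.
- apply: (@le_trans _ _ ((a%:R * lam n + j%:R * eps n) ^+ j)).
    by rewrite ler_pdivrMr ?ltr0n ?fact_gt0 // ler_peMr ?exprn_ge0 // ler1n fact_gt0.
  apply: (@le_trans _ _ ((a%:R * (2 * lam n)) ^+ j)).
    have au : a%:R * lam n + j%:R * eps n <= a%:R * (2 * lam n).
      have : j%:R * eps n <= lam n * 1.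
        by apply: ler_pM => //; [apply: le_trans lk|lra].
      have : lam n <= a%:R * lam n by rewrite ler_peMl // ltW.
      by lra.
    by apply: lerXn2r; rewrite ?nnegrE // (le_trans u0).
  apply: ler_weXn2l => //; apply: (@le_trans _ _ (1 * 1)); first by rewrite mulr1.
  by apply: ler_pM => //; lra.
rewrite ler_expR natrB //; set x : R := (a%:R + j%:R) / n%:R.
have x0 : 0 <= x by rewrite divr_ge0 // addr_ge0.
have -> : (n%:R - a%:R - j%:R) / n%:R = 1 - x by rewrite /x; field; rewrite gt_eqF.
have H : 1 - x - 2 * eps n <= (1 - x) * (1 - eps n) ^+ 2.
  rewrite -subr_ge0; have -> : (1 - x) * (1 - eps n) ^+ 2 - (1 - x - 2 * eps n) =
    eps n * (x * (2 - eps n) + eps n) by ring.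
  by rewrite mulr_ge0 // addr_ge0 // mulr_ge0 //; lra.
have H2 := ler_wpM2l (ltW l0) H.
have xl : lam n * x = lam n * (a%:R / n%:R) + j%:R * (lam n / n%:R).
  by rewrite /x; field; rewrite gt_eqF.
have jl : j%:R * (lam n / n%:R) <= 2^-1.
  by apply: le_trans lnk; apply: ler_wpM2r => //; rewrite divr_ge0 // ltW.
have -> : - (a%:R * lam n * (1 - x) * (1 - eps n) ^+ 2) =
  a%:R * - (lam n * ((1 - x) * (1 - eps n) ^+ 2)) by ring.
rewrite ler_wpM2l //; move: H2.
have -> : lam n * (1 - x - 2 * eps n) = lam n - lam n * x - 2 * (lam n * eps n) by ring.
have -> : lam n * (1 - a%:R / n%:R) = lam n - lam n * (a%:R / n%:R) by ring.
rewrite xl; move: jl le4; 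
move: (lam n * (a%:R / n%:R)) (j%:R * (lam n / n%:R)) (lam n * eps n)
  (lam n * ((1 - x) * (1 - eps n) ^+ 2)) => z1 z2 z3 z4.
by lra.
Unshelve. all: by end_near. Qed.

(** [eta] vanishes and [M ^+ a / a!] is summable. In [M], [expR (1 - c)] bounds
    [n * expR (- lam n)], and [expR 3] joins [expR 2] from the tail exponent to [expR 1] from
    [a ^+ k.+2 <= (k+2)! * expR a], the source of the factorial in [eta]. *)
Let eta n : R := 2 ^+ k * k.+1%:R * (k.+2)`!%:R * (lam n ^+ k.+1 / n%:R).
Let M : R := expR (1 - c) * expR 3.

(** From [a * a <= n] and eventually [lam ^+ 2 <= n] follows [lam * (a / n) <= 1], so the nodes lost
    to [A] itself cost one unit in the exponent. All decay comes from the edge factor [lam / n],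
    through [eta]. *)
Lemma small_set_le : \forall n \near \oo, forall a, (0 < a)%N -> (a * a <= n)%N ->
  'C(n, a)%:R * ((a ^ 2)%:R * (P n)%:R * p n ^+ 2 *
    nout_tail 'I_(P n) (p n) (1 - (1 - p n) ^+ a) (n - a) k.+1) <=
  eta n * (M ^+ a / a`!%:R).
Proof.
near=> n => a a0 aan.
have [n0 e1 l1 np1] : [/\ (0 < n)%N, eps n <= 2^-1, 1 <= lam n & n%:R * p n <= 1].
  by near: n; exact: near_small.
have an : (a <= n)%N by apply: leq_trans aan; rewrite leq_pmulr.
have n0' : 0 < n%:R :> R by rewrite ltr0n.
have l0 : 0 < lam n by apply: lt_le_trans l1.
have a0' : 0 <= a%:R :> R by [].
have la1 : lam n * (a%:R / n%:R) <= 1.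
  have : lam n ^+ 2 / n%:R <= 1 by near: n; apply: near_le_of_cvg (lam_pow_n 2).
  rewrite ler_pdivrMr // mul1r => l2.
  rewrite mulrA ler_pdivrMr // mul1r -ler_sqr ?nnegrE ?mulr_ge0 ?(ltW l0) // exprMn.
  have : a%:R ^+ 2 <= n%:R :> R by rewrite -natrX ler_nat -mulnn.
  by move=> aa; rewrite [leRHS]expr2; apply: ler_pM => //; rewrite sqr_ge0.
have nl : n%:R * expR (- lam n) <= expR (1 - c) by near: n; exact: near_lam_L.
have T_le : nout_tail 'I_(P n) (p n) (1 - (1 - p n) ^+ a) (n - a) k.+1 <=
  k.+1%:R * (a%:R * (2 * lam n)) ^+ k * expR (a%:R * (2 - lam n)).
  have : forall a, (0 < a)%N -> (a <= n)%N ->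
  nout_tail 'I_(P n) (p n) (1 - (1 - p n) ^+ a) (n - a) k.+1 <=
  k.+1%:R * (a%:R * (2 * lam n)) ^+ k * expR (a%:R * (1 - lam n * (1 - a%:R / n%:R))).
    by near: n; exact: set_tail_le.
  move=> /(_ a a0 an) /le_trans; apply; apply: ler_wpM2l.
    by rewrite mulr_ge0 // exprn_ge0 // mulr_ge0 // mulr_ge0 // ltW.
  by rewrite ler_expR ler_wpM2l //; lra.
have Pl : (P n)%:R * p n ^+ 2 = lam n / n%:R by rewrite lam_def; field; rewrite gt_eqF.
have f0 : 0 < a`!%:R :> R by rewrite ltr0n fact_gt0.
have Cn : 'C(n, a)%:R <= n%:R ^+ a / a`!%:R :> R.
  by rewrite ler_pdivlMr //; exact: bin_le_expn.
rewrite -[_ * (P n)%:R * _]mulrA Pl.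
have w0 : 0 <= (a ^ 2)%:R * (lam n / n%:R) by rewrite mulr_ge0 // divr_ge0 // ltW.
have T0 : 0 <= nout_tail 'I_(P n) (p n) (1 - (1 - p n) ^+ a) (n - a) k.+1.
  by apply: (nout_tail_ge0 _ (p01 n)); exact: hit_prob_01.
apply: (le_trans (ler_pM (ler0n _ _) (mulr_ge0 w0 T0) Cn (ler_wpM2l w0 T_le))).
have -> : n%:R ^+ a / a`!%:R * ((a ^ 2)%:R * (lam n / n%:R) *
    (k.+1%:R * (a%:R * (2 * lam n)) ^+ k * expR (a%:R * (2 - lam n)))) =
  (2 ^+ k * k.+1%:R * (lam n ^+ k.+1 / n%:R) / a`!%:R) *
  (a%:R ^+ k.+2 * (n%:R * expR (- lam n) * expR 2) ^+ a).
  rewrite natrX (_ : a%:R * (2 - lam n) = a%:R * - lam n + a%:R * 2); last by ring.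
  rewrite expRD -!expR_natl !exprMn !exprS; ring.
rewrite /eta.
have -> : 2 ^+ k * k.+1%:R * (k.+2)`!%:R * (lam n ^+ k.+1 / n%:R) * (M ^+ a / a`!%:R) =
  (2 ^+ k * k.+1%:R * (lam n ^+ k.+1 / n%:R) / a`!%:R) * ((k.+2)`!%:R * M ^+ a) by ring.
apply: ler_wpM2l.
  apply: mulr_ge0; last by rewrite invr_ge0.
  apply: mulr_ge0; first by rewrite mulr_ge0 // exprn_ge0.
  by rewrite divr_ge0 // exprn_ge0 // ltW.
have -> : M = expR (1 - c) * expR 2 * expR 1.
  by rewrite /M -!expRD; congr expR; ring.
rewrite [(_ * expR 1) ^+ a]exprMn expR_natl mulr1 mulrCA [leRHS]mulrA [leRHS]mulrAC mulrC.
rewrite -[leRHS]mulrA; apply: ler_pM.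
- by rewrite exprn_ge0 // !mulr_ge0 ?expR_ge0.
- by rewrite exprn_ge0.
- apply: lerXn2r; rewrite ?nnegrE ?mulr_ge0 ?expR_ge0 //.
  by apply: ler_wpM2r; rewrite ?expR_ge0.
- by rewrite mulrC; exact: pow_le_fact_expR.
Unshelve. all: by end_near. Qed.

(** Here [C(n, a)] is bounded by [(e n / a) ^ a], and [big_set_exponent] shows that [ln a] outweighs
    the loss [L * (a / n)] from the nodes inside the set. *)
Lemma large_set_le : \forall n \near \oo, forall a, (n < a * a)%N -> (2 * a <= n)%N ->
  'C(n, a)%:R * nout_tail 'I_(P n) (p n) (1 - (1 - p n) ^+ a) (n - a) k.+1 <=
  k.+1%:R / n%:R ^+ 3.
Proof.
near=> n => a naa an2.
have [n0 e1 l1 np1] : [/\ (0 < n)%N, eps n <= 2^-1, 1 <= lam n & n%:R * p n <= 1].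
  by near: n; exact: near_small.
have an : (a <= n)%N by apply: leq_trans an2; rewrite leq_pmull.
have a0 : (0 < a)%N by case: (a) naa => //; rewrite muln0.
have n0' : 0 < n%:R :> R by rewrite ltr0n.
have l0 : 0 < lam n by apply: lt_le_trans l1.
have a0' : 0 < a%:R :> R by rewrite ltr0n.
have T_le : forall a, (0 < a)%N -> (a <= n)%N ->
  nout_tail 'I_(P n) (p n) (1 - (1 - p n) ^+ a) (n - a) k.+1 <=
  k.+1%:R * (a%:R * (2 * lam n)) ^+ k * expR (a%:R * (1 - lam n * (1 - a%:R / n%:R))).
  by near: n; exact: set_tail_le.
have {}T_le := T_le a a0 an.
have nl : n%:R * expR (- lam n) <= expR (1 - c) by near: n; exact: near_lam_L.
pose d := `|1 - c|.
have d0 : 0 <= d by rewrite normr_ge0.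
have Ln : n%:R = expR (L n) by rewrite L_def lnK.
have lL : L n - d <= lam n.
  move: nl; rewrite Ln -expRD ler_expR; have : 1 - c <= d by exact: ler_norm.
  by lra.
(* The exponent per node will be at most [5 + d - L / 4]; this turns it into at most [- L / 8]. *)
have L1 : 8 * (5 + d) <= L n by near: n; exact: near_ge_of_cvgy L_y.
have L0 : 0 <= L n by apply: le_trans L1; lra.
have lam2n : 2 * lam n <= n%:R.
  have : lam n / n%:R <= 2^-1 by near: n; apply: near_le_of_cvg lam_n; rewrite invr_gt0.
  by rewrite ler_pdivrMr //; lra.
(* Then [a * L / 8 >= (2 * k + 3) * L]: a factor [n ^ (2k)] cancels [(a * (2 * lam)) ^+ k], and
   [n ^ 3] remains for the sum over [a]. *)
have aQ : (8 * (2 * k + 3) <= a)%N.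
  have nQ : ((8 * (2 * k + 3)) * (8 * (2 * k + 3)) <= n)%N by near: n; exact: nbhs_infty_ge.
  rewrite leqNgt; apply/negP => h; have := leq_trans naa (leq_trans (ltnW (ltn_mul h h)) nQ).
  by rewrite ltnn.
have f0 : 0 < a`!%:R :> R by rewrite ltr0n fact_gt0.
have Cn : 'C(n, a)%:R <= expR (a%:R * (L n + 1 - ln a%:R)).
  have -> : expR (a%:R * (L n + 1 - ln a%:R)) = n%:R ^+ a * (expR a%:R / a%:R ^+ a).
    rewrite mulrBr mulrDr mulr1 expRB expRD -!expR_natl lnK ?posrE // -Ln; ring.
  apply: (@le_trans _ _ (n%:R ^+ a / a`!%:R)).
    by rewrite ler_pdivlMr //; exact: bin_le_expn.
  apply: ler_wpM2l; first by rewrite exprn_ge0.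
  rewrite ler_pdivlMr ?exprn_gt0 // mulrC ler_pdivrMr // mulrC.
  exact: expn_le_fact_expR.
have T0 : 0 <= nout_tail 'I_(P n) (p n) (1 - (1 - p n) ^+ a) (n - a) k.+1.
  by apply: (nout_tail_ge0 _ (p01 n)); exact: hit_prob_01.
apply: (le_trans (ler_pM (ler0n _ _) T0 Cn T_le)).
rewrite mulrCA -expRD.
apply: (@le_trans _ _ (k.+1%:R * (n%:R * n%:R) ^+ k * expR (- ((2 * k + 3)%:R * L n)))).
  apply: ler_pM; rewrite ?expR_ge0 //.
  - by rewrite mulr_ge0 // exprn_ge0 // mulr_ge0 ?(ltW a0') // mulr_ge0 // ltW.
  - apply: ler_wpM2l => //; apply: lerXn2r; rewrite ?nnegrE ?mulr_ge0 ?(ltW l0) //.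
    by apply: ler_pM; rewrite ?mulr_ge0 ?(ltW l0) // ler_nat.
  rewrite ler_expR -mulrDr.
  have y0 : 0 <= a%:R / n%:R :> R by rewrite divr_ge0.
  have y1 : a%:R / n%:R <= 1 :> R by rewrite ler_pdivrMr // mul1r ler_nat.
  have h1 : (L n - d) * (1 - a%:R / n%:R) <= lam n * (1 - a%:R / n%:R).
    by apply: ler_wpM2r => //; rewrite subr_ge0.
  have h2 : d * (1 - a%:R / n%:R) <= d by rewrite ler_piMr // gerBl.
  have h3 := @big_set_exponent R a n n0 (ltnW naa) an2; rewrite -L_def in h3.
  have h4 : L n + 1 - ln a%:R + (1 - lam n * (1 - a%:R / n%:R)) <= - (L n / 8).
    move: h1 h2 h3; rewrite !mulrBl !mulrBr !mulr1.
    move: (L n * (a%:R / n%:R)) (lam n * (a%:R / n%:R)) (d * (a%:R / n%:R)) (ln a%:R).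
    by move=> z1 z2 z3 z4; lra.
  apply: le_trans (ler_wpM2l (ltW a0') h4) _.
  have aQ' : 8 * (2 * k + 3)%:R <= a%:R :> R by rewrite -natrM ler_nat.
  have := ler_wpM2r L0 aQ'; lra.
have -> : expR (- ((2 * k + 3)%:R * L n)) = (n%:R ^+ k * n%:R ^+ k * n%:R ^+ 3)^-1.
  by rewrite expRN -expR_natl -Ln -!exprD; congr ((_ ^+ _)^-1); rewrite mul2n -addnn.
rewrite exprMn le_eqVlt; apply/orP; left; apply/eqP.
have nk : n%:R ^+ k != 0 :> R by rewrite expf_neq0 // gt_eqF.
have nn : n%:R != 0 :> R by rewrite gt_eqF.
by move: nk; move: (n%:R ^+ k) => z z0; field; rewrite z0 nn.
Unshelve. all: by end_near. Qed.

Lemma gap_cvg : mindeg_prob 'I_n 'I_(P n) (p n) k.+1 -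
  conn_prob 'I_n 'I_(P n) (p n) k.+1 @[n --> \oo] --> (0 : R).
Proof.
apply: (@squeeze_cvgr _ _ _ _ (fun=> 0)
  (fun n => eta n * expR M + 2 * k.+1%:R * ((n%:R)^-1 * (n%:R)^-1))).
- near=> n; have n1 : (1 < n)%N by near: n; exact: nbhs_infty_gt.
  have n0' : 0 < n%:R :> R by rewrite ltr0n ltnW.
  have l1 : 1 <= lam n by near: n; exact: near_ge_of_cvgy lam_y.
  have l0 : 0 <= lam n by apply: le_trans l1.
  have sm : forall a, (0 < a)%N -> (a * a <= n)%N ->
    'C(n, a)%:R * ((a ^ 2)%:R * (P n)%:R * p n ^+ 2 *
      nout_tail 'I_(P n) (p n) (1 - (1 - p n) ^+ a) (n - a) k.+1) <=
    eta n * (M ^+ a / a`!%:R) by near: n; exact: small_set_le.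
  have lg : forall a, (n < a * a)%N -> (2 * a <= n)%N ->
    'C(n, a)%:R * nout_tail 'I_(P n) (p n) (1 - (1 - p n) ^+ a) (n - a) k.+1 <=
    k.+1%:R / n%:R ^+ 3 by near: n; exact: large_set_le.
  have eta0 : 0 <= eta n.
    by apply: mulr_ge0; [rewrite !mulr_ge0 ?exprn_ge0|rewrite divr_ge0 // exprn_ge0].
  have M0 : 0 <= M by rewrite mulr_ge0 ?expR_ge0.
  have cV : (1 < #|'I_n|)%N by rewrite card_ord.
  rewrite subr_ge0 (conn_le_mindeg _ _ (p01 n) cV) /=.
  pose T a := nout_tail 'I_(P n) (p n) (1 - (1 - p n) ^+ a) (n - a) k.+1.
  pose g a := if (a * a <= n)%N then (a ^ 2)%:R * (P n)%:R * p n ^+ 2 * T a else T a.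
  have hg (A : {set 'I_n}) : (2 <= #|A|)%N -> (2 * #|A| <= #|'I_n|)%N ->
     bern_E (p n) (fun X : {set 'I_n * 'I_(P n)} =>
       (inner_edge X A && (#|nout X A A| < k.+1)%N)%:R) <= g #|A|.
    move=> A2 An; have cA : #|~: A| = (n - #|A|)%N by rewrite cardsCs finset.setCK card_ord.
    rewrite /g; case: ifP => _.
      have := @inner_nout_le R 'I_n 'I_(P n) (p n) (p01 n) A k.+1.
      by rewrite cA card_ord.
    have := @nout_tail_law R 'I_n 'I_(P n) (p n) A A k.+1 (subxx _).
    rewrite /T -cA => <-; apply: ler_bern_E => // X; rewrite ler_nat.
    by case: (inner_edge X A).
  have := mindeg_le_conn (p01 n) hg; rewrite card_ord -lerBlDl => /le_trans; apply.
  apply: (@le_trans _ _ (\sum_(a < n.+1 | (1 < a)%N && (2 * a <= n)%N)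
     (eta n * (M ^+ a / a`!%:R) + k.+1%:R / n%:R ^+ 3))).
    apply: ler_sum => a /andP[a2 an2]; rewrite /g; case: leqP => ha.
      apply: ler_wpDr; first by rewrite divr_ge0 // exprn_ge0.
      by apply: sm => //; exact: ltnW.
    apply: ler_wpDl; last exact: lg.
    by rewrite mulr_ge0 // divr_ge0 // exprn_ge0.
  apply: (@le_trans _ _ (\sum_(a < n.+1) (eta n * (M ^+ a / a`!%:R) + k.+1%:R / n%:R ^+ 3))).
    rewrite [leRHS](bigID (fun a : 'I_n.+1 => (1 < a)%N && (2 * a <= n)%N)) /=.
    rewrite lerDl; apply: sumr_ge0 => a _; apply: addr_ge0.
      by rewrite mulr_ge0 // divr_ge0 // exprn_ge0.
    by rewrite divr_ge0 // exprn_ge0.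
  rewrite big_split /= -mulr_sumr; apply: lerD.
    by apply: ler_wpM2l => //; exact: sum_exp_coeff_le.
  rewrite sumr_const card_ord -[_ *+ n.+1]mulr_natr.
  have n2 : n.+1%:R <= 2 * n%:R :> R by rewrite -natr1 mulr_natl mulr2n lerD2l ler1n ltnW.
  have kn : 0 <= k.+1%:R / n%:R ^+ 3 :> R by rewrite divr_ge0 // exprn_ge0.
  apply: le_trans (ler_wpM2l kn n2) _; rewrite le_eqVlt; apply/orP; left; apply/eqP.
  by field; rewrite gt_eqF.
- exact: cvg_cst.
- apply: (@cvg_to_eq _ _ (2 ^+ k * k.+1%:R * (k.+2)`!%:R * 0 * expR M + 2 * k.+1%:R * (0 * 0))).
    by rewrite !mulr0 mul0r addr0.
  have inv0 : (n%:R)^-1 @[n --> \oo] --> (0 : R) by apply: cvgV_y; exact: cvg_natr_y.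
  apply: cvgD; last by apply: cvgM; [exact: cvg_cst|apply: cvgM; exact: inv0].
  by apply: cvgM; [apply: cvgM; [exact: cvg_cst|exact: lam_pow_n]|exact: cvg_cst].
Unshelve. all: by end_near. Qed.

Lemma conn_cvg : conn_prob 'I_n 'I_(P n) (p n) k.+1 @[n --> \oo] --> expR (- mu).
Proof.
apply: (@cvg_near_eq _ _ (fun n => mindeg_prob 'I_n 'I_(P n) (p n) k.+1 -
  (mindeg_prob 'I_n 'I_(P n) (p n) k.+1 - conn_prob 'I_n 'I_(P n) (p n) k.+1))).
  by near=> n; rewrite subKr.
by apply: (@cvg_to_eq _ _ (expR (- mu) - 0)); [rewrite subr0|apply: cvgB mindeg_cvg gap_cvg].
Unshelve. all: by end_near. Qed.

End Critical.

(** * Zero-one laws *)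

Section ZeroOneLaws.
Variables (R : realType) (k : nat) (P : nat -> nat).
Hypothesis P_gt0 : forall n, (0 < P n)%N.
Hypothesis P_big : \forall n \near \oo, n%:R * ln n%:R ^+ 5 <= (P n)%:R :> R.

Lemma critical_limit (p al : nat -> R) (c : R) : (forall n, 0 <= p n <= 1) ->
  (\forall n \near \oo, n%:R * (p n ^+ 2 * (P n)%:R) = ln n%:R + k%:R * ln (ln n%:R) + al n) ->
  al n @[n --> \oo] --> c ->
  conn_prob 'I_n 'I_(P n) (p n) k.+1 @[n --> \oo] --> expR (- (expR (- c) / k`!%:R)).
Proof.
move=> p01 lamE al_c.
exact: (@conn_cvg R k P p al c _ _ _ (fun=> erefl) (fun=> erefl) (fun=> erefl) p01 lamE al_c P_big).
Qed.

Lemma critical_prob_exists (c : R) : exists2 p : nat -> R, forall n, 0 <= p n <= 1 &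
  \forall n \near \oo, n%:R * (p n ^+ 2 * (P n)%:R) = ln n%:R + k%:R * ln (ln n%:R) + c.
Proof.
pose x n : R := (ln n%:R + k%:R * ln (ln n%:R) + c) / (n%:R * (P n)%:R).
(* The square root solves the equation for [p]; 0 is the default for the finitely many [n] where
   [x n] may leave the unit interval. *)
exists (fun n => if 0 <= x n <= 1 then Num.sqrt (x n) else 0) => [n|].
  by case: ifP => [/andP[x0 x1]|_]; rewrite ?lexx ?ler01 // sqrtr_ge0 /= -sqrtr1 ler_wsqrtr.
have Ly : ln n%:R @[n --> \oo] --> (+oo : set_system R).
  by apply: cvg_ln_y; exact: cvg_natr_y.
near=> n.
have n0 : (0 < n)%N by near: n; exact: nbhs_infty_gt.
have n0' : 0 < n%:R :> R by rewrite ltr0n.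
have P0 : 1 <= (P n)%:R :> R by rewrite ler1n.
have nP : n%:R <= n%:R * (P n)%:R :> R by rewrite ler_peMr // ltW.
have L1 : 1 + `|c| <= ln n%:R :> R by near: n; exact: near_ge_of_cvgy Ly.
have lL : 0 <= ln (ln n%:R) :> R by rewrite ln_ge0 //; apply: le_trans L1; rewrite lerDl.
have L0 : 0 < ln n%:R :> R by apply: lt_le_trans L1; rewrite ltr_pwDl.
have lL2 : ln (ln n%:R) <= ln n%:R :> R.
  exact: ltW (ln_sublinear L0).
(* The numerator of [x n] is at most [k.+2] times [ln n]: once for [ln n], [k] times for the
   iterated logarithm, once for [c]. *)
have Ln : ln n%:R ^+ 1 / n%:R <= (k.+2%:R)^-1 :> R.
  near: n; apply: (@near_le_of_cvg R _ 0); first by rewrite invr_gt0.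
  by apply: cvg_ln_pow_div; exact: cvg_natr_y.
have cl : - `|c| <= c <= `|c| by rewrite lerNnormlW // ler_norm.
have num0 : 0 <= ln n%:R + k%:R * ln (ln n%:R) + c.
  have : 0 <= k%:R * ln (ln n%:R) :> R by rewrite mulr_ge0.
  by case/andP: cl; lra.
have numn : ln n%:R + k%:R * ln (ln n%:R) + c <= n%:R.
  move: Ln; rewrite expr1 ler_pdivrMr // mulrC ler_pdivlMr // => Ln.
  have : k%:R * ln (ln n%:R) <= k%:R * ln n%:R :> R by rewrite ler_wpM2l.
  case/andP: cl => _ c1; move: Ln; rewrite -addn2 natrD mulrDr [_ * k%:R]mulrC.
  by lra.
have nP0 : 0 < n%:R * (P n)%:R :> R by apply: lt_le_trans nP.
have -> : 0 <= x n <= 1.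
  by rewrite divr_ge0 ?(ltW nP0) //= ler_pdivrMr // mul1r (le_trans numn).
rewrite sqr_sqrtr; last by rewrite divr_ge0 ?(ltW nP0).
have Pn : (P n)%:R != 0 :> R by rewrite pnatr_eq0 -lt0n.
have nn : n%:R != 0 :> R by rewrite gt_eqF.
by rewrite /x; field; rewrite Pn nn.
Unshelve. all: by end_near. Qed.

Lemma conn_prob_le1 (p : R) n m : 0 <= p <= 1 -> conn_prob 'I_n 'I_m p k.+1 <= 1.
Proof.
move=> p01; rewrite -[leRHS](@bern_E_cst R ('I_n * 'I_m)%type p); apply: ler_bern_E => // X.
by rewrite lern1 leq_b1.
Qed.

Lemma conn_prob_ge0 (p : R) n m : 0 <= p <= 1 -> 0 <= conn_prob 'I_n 'I_m p k.+1.
Proof. by move=> p01; apply: bern_E_ge0. Qed.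

Section Comparison.
Variables (p al : nat -> R).
Hypothesis p01 : forall n, 0 <= p n <= 1.
Hypothesis pE : forall n, (2 <= n)%N ->
  n%:R * (p n ^+ 2 * (P n)%:R) = ln n%:R + k%:R * ln (ln n%:R) + al n.

Lemma prob_le_of_alpha_le (q be : nat -> R) n : (forall n, 0 <= q n <= 1) -> (2 <= n)%N ->
  n%:R * (q n ^+ 2 * (P n)%:R) = ln n%:R + k%:R * ln (ln n%:R) + be n ->
  (al n <= be n -> p n <= q n) /\ (be n <= al n -> q n <= p n).
Proof.
move=> q01 n2 qE; have n0 : 0 < n%:R :> R by rewrite ltr0n ltnW.
have P0 : 0 < (P n)%:R :> R by rewrite ltr0n.
have /andP[p0 _] := p01 n; have /andP[q0 _] := q01 n.
have H (x y : R) : 0 <= x -> 0 <= y ->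
    n%:R * (x ^+ 2 * (P n)%:R) <= n%:R * (y ^+ 2 * (P n)%:R) -> x <= y.
  by move=> x0 y0; rewrite ler_pM2l // ler_pM2r // ler_sqr.
by split=> h; apply: H => //; rewrite pE // qE lerD2l.
Qed.

Lemma subcritical_limit : al n @[n --> \oo] --> -oo ->
  conn_prob 'I_n 'I_(P n) (p n) k.+1 @[n --> \oo] --> (0 : R).
Proof.
move=> aly; apply/cvgrPdist_le => e e0.
(* The limit for the constant [- C] is [expR (- y)] with [y = expR C / k!]. Then
   [y > C / k! = 1 / e], so [expR (- y) < 1 / y < e]. *)
pose C : R := k`!%:R / e.
have f0 : 0 < k`!%:R :> R by rewrite ltr0n fact_gt0.
have [q q01 qE] := critical_prob_exists (- C).
have cc : (fun=> - C) n @[n --> \oo] --> - C by exact: cvg_cst.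
have ql := critical_limit q01 qE cc.
have lt : expR (- (expR (- - C) / k`!%:R)) < e.
  rewrite opprK expRN; set y := expR C / _.
  have yC : e^-1 < y.
    rewrite ltr_pdivlMr // mulrC -/C; apply: lt_le_trans (expR_ge1Dx C); by rewrite ltrDr.
  rewrite -[e]invrK ltf_pV2 ?posrE ?expR_gt0 ?invr_gt0 //.
  by apply: lt_le_trans yC (le_trans _ (expR_ge1Dx y)); rewrite lerDr.
near=> n; rewrite sub0r normrN ger0_norm ?conn_prob_ge0 //.
have n2 : (2 <= n)%N by near: n; exact: nbhs_infty_ge.
have qn : n%:R * (q n ^+ 2 * (P n)%:R) = ln n%:R + k%:R * ln (ln n%:R) - C by near: n.
have aC : al n <= - C by near: n; move/cvgrNyPle: aly; exact.
have [/(_ aC) pq _] := @prob_le_of_alpha_le q (fun=> - C) n q01 n2 qn.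
have /andP[p0 _] := p01 n; have /andP[_ q1] := q01 n.
apply: le_trans (conn_prob_mono _ _ _ p0 pq q1) _.
by near: n; exact: near_le_of_cvg lt ql.
Unshelve. all: by end_near. Qed.

Lemma supercritical_limit : al n @[n --> \oo] --> +oo ->
  conn_prob 'I_n 'I_(P n) (p n) k.+1 @[n --> \oo] --> (1 : R).
Proof.
move=> aly; apply/cvgrPdist_le => e e0.
(* One minus the limit for the constant [C] is at most [expR (- C)], which is below [1 / C = e]. *)
pose C : R := e^-1.
have f0 : 1 <= k`!%:R :> R by rewrite ler1n fact_gt0.
have [q q01 qE] := critical_prob_exists C.
have cc : (fun=> C) n @[n --> \oo] --> C by exact: cvg_cst.
have ql := critical_limit q01 qE cc.
have lt : 1 - expR (- (expR (- C) / k`!%:R)) < e.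
  have h1 : expR (- C) < e.
    rewrite expRN -[e]invrK ltf_pV2 ?posrE ?expR_gt0 ?invr_gt0 //.
    by apply: lt_le_trans (expR_ge1Dx _); rewrite ltrDr.
  have h2 := expR_ge1Dx (- (expR (- C) / k`!%:R)).
  have h3 : expR (- C) / k`!%:R <= expR (- C).
    by rewrite ler_pdivrMr ?(lt_le_trans _ f0) // ler_peMr ?expR_ge0.
  by lra.
near=> n; rewrite ger0_norm ?subr_ge0 ?conn_prob_le1 //.
have n2 : (2 <= n)%N by near: n; exact: nbhs_infty_ge.
have qn : n%:R * (q n ^+ 2 * (P n)%:R) = ln n%:R + k%:R * ln (ln n%:R) + C by near: n.
have aC : C <= al n by near: n; exact: near_ge_of_cvgy aly.
have [_ /(_ aC) qp] := @prob_le_of_alpha_le q (fun=> C) n q01 n2 qn.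
have /andP[_ p1] := p01 n; have /andP[q0 _] := q01 n.
apply: (@le_trans _ _ (1 - conn_prob 'I_n 'I_(P n) (q n) k.+1)).
  by rewrite lerD2l lerN2; apply: conn_prob_mono.
near: n; apply: near_le_of_cvg lt _; apply: cvgB ql; exact: cvg_cst.
Unshelve. all: by end_near. Qed.

End Comparison.

End ZeroOneLaws.

(** An assignment is the curried form of a set of node-object pairs. The bijection preserves weights
    and graphs, and on sets of pairs independence is disjointness of coordinate blocks. *)
Lemma binomial_rig_probE (R : realType) (n m k : nat) (p : R) :
  binomial_rig_prob m p (fun G : rel 'I_n => k_connected G k) = conn_prob 'I_n 'I_m p k.
Proof.
pose h (X : {set 'I_n * 'I_m}) : object_assignment n m := [ffun i => [set o | (i, o) \in X]%SET].
pose h' (S : object_assignment n m) : {set 'I_n * 'I_m} := [set z | z.2 \in S z.1]%SET.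
have hK : cancel h h' by move=> X; apply/setP => -[i o]; rewrite inE /= ffunE inE.
have h'K : cancel h' h by move=> S; apply/ffunP => i; apply/setP => o; rewrite ffunE !inE.
have graphE X : intersection_graph (h X) = rig X.
  apply/funext => i; apply/funext => j; rewrite /intersection_graph /rig /=; congr (_ && _).
  apply/finset.set0Pn/existsP => -[x hx]; exists x; move: hx; by rewrite inE !ffunE !inE.
rewrite /binomial_rig_prob (reindex h) /=; last by exists h' => X _.
rewrite big_mkcond /=; apply: eq_bigr => X _; rewrite graphE.
have -> : assignment_weight p (h X) = bern_weight p X.
  rewrite /assignment_weight /bern_weight pair_bigA /=; apply: eq_bigr => -[i o] _ /=.
  by rewrite ffunE inE.
by case: asboolP => _; rewrite ?mulr1 ?mulr0.
Qed.

Theorem theorem2 (R : realType) (k : nat) (P : nat -> nat) (p alpha : nat -> R)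
    (k_gt0 : (0 < k)%N)
    (P_gt0 : forall n, (0 < P n)%N)
    (p_ge0_le1 : forall n, 0 <= p n <= 1)
    (alpha_def : forall n, (2 <= n)%N ->
       p n ^+ 2 * (P n)%:R =
       (ln n%:R + (k - 1)%N%:R * ln (ln n%:R) + alpha n) / n%:R)
    (P_omega : little_omega (fun n => (P n)%:R : R)
                            (fun n => n%:R * ln n%:R ^+ 5))
    (alpha_o : (fun n => `|alpha n|) =o_\oo (fun n => ln n%:R : R)) :
  let prob n :=
    binomial_rig_prob (P n) (p n) (fun G : rel 'I_n => k_connected G k) in
  [/\ alpha n @[n --> \oo] --> -oo -> prob n @[n --> \oo] --> (0 : R),
      alpha n @[n --> \oo] --> +oo -> prob n @[n --> \oo] --> (1 : R) &
      forall alpha_star : R,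
        alpha n @[n --> \oo] --> alpha_star ->
        prob n @[n --> \oo] -->
          expR (- (expR (- alpha_star) / ((k - 1)`!)%:R))].
Proof.
case: k k_gt0 alpha_def => // k _; rewrite subn1 /= => alpha_def.
have P_big : \forall n \near \oo, n%:R * ln n%:R ^+ 5 <= (P n)%:R :> R.
  have /eqoP/(_ 1 ltr01) := P_omega; apply: filterS => n.
  by rewrite mul1r [X in _ <= X -> _]ger0_norm // => /(le_trans (ler_norm _)).
have pE n : (2 <= n)%N ->
    n%:R * (p n ^+ 2 * (P n)%:R) = ln n%:R + k%:R * ln (ln n%:R) + alpha n.
  move=> n2; rewrite alpha_def // mulrC divfK // pnatr_eq0 -lt0n; exact: ltnW.
have -> : (fun n => binomial_rig_prob (P n) (p n) (fun G : rel 'I_n => k_connected G k.+1)) =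
    (fun n => conn_prob 'I_n 'I_(P n) (p n) k.+1).
  by apply/funext => n; rewrite binomial_rig_probE.
split.
- exact: subcritical_limit.
- exact: supercritical_limit.
- move=> a; apply: critical_limit => //; near=> n; apply: pE; near: n; exact: nbhs_infty_ge.
Unshelve. all: by end_near. Qed.
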